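(* Let $V_1,V_2$ be finite-dimensional complex superspaces, $\dim V_i=N_i=m_i+n_i\varepsilon$, where $m_1=n_1\ge1$ and $N_2\ne1$, $\varepsilon$, $1+\varepsilon$. Let $V=V_1\otimes V_2$. Then the Lie subsuperalgebra $\mathfrak g=\mathfrak q(V_1)\odot\mathfrak{gl}(V_2)$ is maximal in $\mathfrak q(V)$ if $m_2\ne n_2$; it is maximal in $\mathfrak{sq}(V)$ if $m_2=n_2$.
   Context: The superdimension of $V=V_{\bar0}\oplus V_{\bar1}$ is written $\dim V=\dim V_{\bar0}+\varepsilon\dim V_{\bar1}$, $\varepsilon^2=1$. For an odd operator $J$ on an $n|n$-dimensional superspace $V$ with $J^2=-\mathrm{id}$, $\mathfrak q(V)=C(J)=\{X\in\mathfrak{gl}(V)\mid[X,J]=0\}$ (supercommutator). In a basis where $J=\begin{pmatrix} 0 & 1_n \\ -1_n & 0 \end{pmatrix}$, it consists of matrices $\begin{pmatrix} A & B \\ B & A \end{pmatrix}$; the queer trace is $\mathrm{qtr}\begin{pmatrix} A & B \\ B & A \end{pmatrix}=\mathrm{tr}\,B$ and $\mathfrak{sq}(V)=\{X\in\mathfrak q(V)\mid\mathrm{qtr}X=0\}$. Here $\mathfrak q(V_1)=C(J_1)$ and $\mathfrak q(V)=C(J)$ with $J=J_1\otimes1$. $\mathfrak g_1\odot\mathfrak g_2\subset\mathfrak{gl}(V_1\otimes V_2)$ denotes the image of $\mathfrak g_1\oplus\mathfrak g_2$ under $X_1+X_2\mapsto X_1\otimes1+1\otimes X_2$. Maximal means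 proper and not contained in a strictly larger proper Lie subsuperalgebra. *)

(* Defs.v *)
From HB Require Import structures.
From mathcomp Require Import all_boot all_order all_algebra.
Set Implicit Arguments. Unset Strict Implicit. Unset Printing Implicit Defensive.
Import GRing.Theory.
Local Open Scope ring_scope.

(* Parities are booleans: [false] is even, [true] is odd, [(+)] is addition. *)
Record superspace (K : fieldType) := SuperSpace {
  scarrier :> vectType K;
  spart : bool -> {vspace scarrier};
  spart_add : (spart false + spart true)%VS = fullv;
  spart_cap : (spart false :&: spart true)%VS = 0%VS }.

(* The superdimension m + n eps is encoded as the pair (m, n). *)
Definition sdim (K : fieldType) (V : superspace K) : nat * nat :=
  (\dim (spart V false), \dim (spart V true)).

Section Operators.
Variables (K : fieldType) (V : superspace K).
Implicit Types (X Y Z J : 'End(V)) (a b c : bool).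

Definition sproj a : 'End(V) := daddv_pi (spart V a) (spart V (~~ a)).

Definition parity_is a X : bool :=
  [forall b : bool, (X @: spart V b <= spart V (a (+) b))%VS].

(* The component of parity a of an arbitrary operator. *)
Definition hcomp a X : 'End(V) :=
  \sum_(b : bool) (sproj (a (+) b) \o X \o sproj b)%VF.

(* The supercommutator, extended bilinearly from homogeneous operators. *)
Definition sbr X Y : 'End(V) :=
  \sum_(a : bool) \sum_(b : bool)
    ((hcomp a X \o hcomp b Y)%VF
       - (-1) ^+ (a && b) *: (hcomp b Y \o hcomp a X)%VF).

Lemma spart_capN a : (spart V a :&: spart V (~~ a))%VS = 0%VS.
Proof. by case: a; rewrite /= ?[(spart V true :&: _)%VS]capvC spart_cap. Qed.

Lemma sproj_mem a v : sproj a v \in spart V a.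
Proof. exact: memv_pi. Qed.

Lemma sproj_id a v : v \in spart V a -> sproj a v = v.
Proof. by move=> va; apply: daddv_pi_id; rewrite ?spart_capN. Qed.

Lemma sproj_sum v : sproj false v + sproj true v = v.
Proof.
by apply: daddv_pi_add; [exact: spart_cap | rewrite spart_add memvf].
Qed.

Lemma sproj_0 a v : v \in spart V (~~ a) -> sproj a v = 0.
Proof.
move=> va; have := sproj_sum v; case: a va => /= va.
  by rewrite (sproj_id va) => /(canRL (addKr _)); rewrite addNr.
by rewrite (sproj_id va) => /(canRL (addrK _)); rewrite subrr.
Qed.

Lemma parity_isP a X :
  reflect (forall b v, v \in spart V b -> X v \in spart V (a (+) b))
          (parity_is a X).
Proof.
apply: (iffP forallP) => [h b v vb | h b].
  exact: (subvP (h b)) (memv_img X vb).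
by apply/subvP => _ /memv_imgP[v vb ->]; apply: h.
Qed.

Lemma hcompE a X v :
  hcomp a X v = sproj (~~ a) (X (sproj true v)) + sproj a (X (sproj false v)).
Proof.
by rewrite /hcomp sum_lfunE big_bool /= !lfunE /= !lfunE /= addbT addbF.
Qed.

Lemma hcomp_parity a X : parity_is a (hcomp a X).
Proof.
apply/parity_isP => b v vb; rewrite hcompE; case: b vb => vb.
  by rewrite (sproj_0 (a := false)) // !linear0 addr0 addbT sproj_mem.
by rewrite (sproj_0 (a := true)) // !linear0 add0r addbF sproj_mem.
Qed.

Lemma hcomp_sum X : hcomp false X + hcomp true X = X.
Proof.
apply/lfunP => v; rewrite add_lfunE !hcompE /= addrACA sproj_sum.
by rewrite [X in X + _]addrC sproj_sum -[in RHS](sproj_sum v) linearD addrC.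
Qed.

Lemma hcomp_id a X : parity_is a X -> hcomp a X = X.
Proof.
move=> /parity_isP h; apply/lfunP => v; rewrite hcompE.
have h1 := h _ _ (sproj_mem true v); have h0 := h _ _ (sproj_mem false v).
rewrite addbT in h1; rewrite addbF in h0.
by rewrite (sproj_id h1) (sproj_id h0) addrC -[in RHS](sproj_sum v) linearD.
Qed.

Lemma hcomp_0 a X : parity_is (~~ a) X -> hcomp a X = 0.
Proof.
move=> h; have := hcomp_sum X; case: a h => /= h.
  by rewrite (hcomp_id h) => /(canRL (addKr _)); rewrite addNr.
by rewrite (hcomp_id h) => /(canRL (addrK _)); rewrite subrr.
Qed.

Lemma hcomp_linear a : linear (hcomp a).
Proof.
move=> k X Y; apply/lfunP => v.
by rewrite !(hcompE, add_lfunE, scale_lfunE) !linearD !linearZ /= addrACA.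
Qed.
HB.instance Definition _ a :=
  GRing.isLinear.Build K 'End(V) 'End(V) _ (hcomp a) (hcomp_linear a).

Lemma sbrE a b X Y : parity_is a X -> parity_is b Y ->
  sbr X Y = (X \o Y)%VF - (-1) ^+ (a && b) *: (Y \o X)%VF.
Proof.
move=> hX hY; rewrite /sbr (bigD1 a) //= [X in _ + X]big1 ?addr0; last first.
  move=> a' na; rewrite (hcomp_0 (a := a')); last first.
    by have -> : ~~ a' = a by case: a' a na {hX} => [] [].
  by rewrite big1 // => b' _; rewrite comp_lfun0l comp_lfun0r scaler0 subrr.
rewrite (bigD1 b) //= [X in _ + X]big1 ?addr0; last first.
  move=> b' nb; rewrite (hcomp_0 (X := Y) (a := b')); last first.
    by have -> : ~~ b' = b by case: b' b nb {hY} => [] [].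
  by rewrite comp_lfun0l comp_lfun0r scaler0 subrr.
by rewrite !hcomp_id.
Qed.

Lemma sbr_linearl Y : linear (sbr^~ Y).
Proof.
move=> k X X'; rewrite /sbr scaler_sumr -big_split; apply: eq_bigr => a _ /=.
rewrite scaler_sumr -big_split; apply: eq_bigr => b _ /=.
rewrite linearD linearZ /= comp_lfunDl comp_lfunDr -comp_lfunZl -comp_lfunZr.
rewrite scalerDr scalerBr opprD !scalerA [k * _]mulrC.
by rewrite addrACA.
Qed.
Definition sbrr Y X := sbr X Y.
HB.instance Definition _ Y :=
  GRing.isLinear.Build K 'End(V) 'End(V) _ (sbrr Y) (sbr_linearl Y).

(* q(V) = C(J). *)
Definition qalg J : {vspace 'End(V)} := lker (linfun (sbrr J)).

Lemma mem_qalg J X : (X \in qalg J) = (sbr X J == 0).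
Proof. by rewrite memv_ker lfunE. Qed.

(* The matrix of X in the basis b, acting on column vectors. *)
Definition lfun_mx n (b : n.-tuple V) X : 'M[K]_n :=
  \matrix_(i, j) coord b i (X b`_j).

(* The homogeneous bases (e, f) in which J = (0, 1; -1, 0). *)
Definition queer_basis J n (e f : n.-tuple V) : bool :=
  [&& basis_of (spart V false) e, basis_of (spart V true) f
    & lfun_mx (cat_tuple e f) J == block_mx 0 1%:M (- 1%:M) 0].

Definition qtr_in n (e f : n.-tuple V) X : K :=
  \tr (ursubmx (lfun_mx (cat_tuple e f) X)).

Definition queer_even := vbasis (spart V false).
Definition queer_odd J := map_tuple (fun v => - J v) queer_even.

(* The queer trace is computed in the basis (e, - J e), with e any basis of the
   even part; [queer_basisP] and [qtrE] below show that this is legitimate. *)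
Definition qtr J X : K := qtr_in queer_even (queer_odd J) X.

Lemma qtr_linear J : linear (qtr J : 'End(V) -> K^o).
Proof.
move=> k X Y; rewrite /qtr /qtr_in -linearZ -linearD /=; congr (\tr _).
by apply/matrixP => i j; rewrite !mxE add_lfunE scale_lfunE linearD linearZ.
Qed.
HB.instance Definition _ J :=
  GRing.isLinear.Build K 'End(V) K^o _ (qtr J) (qtr_linear J).

Lemma spart_basis n (e f : n.-tuple V) :
  basis_of (spart V false) e -> basis_of (spart V true) f ->
  basis_of fullv (cat_tuple e f).
Proof.
move=> be bf; rewrite -(spart_add V); apply: cat_basis => //.
by apply/directv_addP; exact: spart_cap.
Qed.

Lemma nth_catl n (e f : n.-tuple V) (j : 'I_n) :
  (cat_tuple e f)`_(lshift n j) = e`_j.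
Proof. by rewrite /= nth_cat size_tuple ltn_ord. Qed.

Lemma nth_catr n (e f : n.-tuple V) (j : 'I_n) :
  (cat_tuple e f)`_(rshift n j) = f`_j.
Proof. by rewrite /= nth_cat size_tuple ltnNge leq_addr /= addKn. Qed.

Lemma coord_cat n (e f : n.-tuple V) v (i : 'I_n) :
  basis_of (spart V false) e -> basis_of (spart V true) f ->
  coord (cat_tuple e f) (lshift n i) v = coord e i (sproj false v) /\
  coord (cat_tuple e f) (rshift n i) v = coord f i (sproj true v).
Proof.
move=> be bf; have bef := spart_basis be bf.
set k := fun j : 'I_(n + n) => match split j with
  | inl j => coord e j (sproj false v) | inr j => coord f j (sproj true v) end.
have kl j : k (lshift n j) = coord e j (sproj false v).
  by rewrite /k (unsplitK (inl j)).
have kr j : k (rshift n j) = coord f j (sproj true v).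
  by rewrite /k (unsplitK (inr j)).
have vE : v = \sum_j k j *: (cat_tuple e f)`_j.
  rewrite -[LHS]sproj_sum big_split_ord.
  rewrite {1}(coord_basis be (sproj_mem _ v)) {1}(coord_basis bf (sproj_mem _ v)).
  by congr (_ + _); apply: eq_bigr => j _;
    [rewrite kl nth_catl | rewrite kr nth_catr].
by split; [rewrite -kl | rewrite -kr]; rewrite {1}vE coord_sum_free // (basis_free bef).
Qed.

Lemma queer_basisE J n (e f : n.-tuple V) :
  queer_basis J e f ->
  forall j : 'I_n, J f`_j = e`_j /\ J e`_j = - f`_j.
Proof.
case/and3P => be bf /eqP Jef j; have bef := spart_basis be bf.
have Jcol (k : 'I_(n + n)) : J (cat_tuple e f)`_k =
    \sum_i lfun_mx (cat_tuple e f) J i k *: (cat_tuple e f)`_i.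
  rewrite {1}(coord_basis bef (memvf (J _))); apply: eq_bigr => i _.
  by rewrite mxE.
split.
  rewrite -(nth_catr e f) Jcol Jef big_split_ord /=.
  rewrite [X in _ + X]big1 ?addr0; last first.
    by move=> i _; rewrite block_mxEdr mxE scale0r.
  rewrite (bigD1 j) //= big1 ?addr0; last first.
    by move=> i ij; rewrite block_mxEur mxE (negPf ij) scale0r.
  by rewrite block_mxEur mxE eqxx scale1r (nth_catl e f).
rewrite -(nth_catl e f) Jcol Jef big_split_ord /=.
rewrite [X in X + _]big1 ?add0r; last first.
  by move=> i _; rewrite block_mxEul mxE scale0r.
rewrite (bigD1 j) //= big1 ?addr0; last first.
  by move=> i ij; rewrite block_mxEdl !mxE (negPf ij) oppr0 scale0r.
by rewrite block_mxEdl !mxE eqxx scaleN1r (nth_catr e f).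
Qed.

Lemma queer_basisP J :
  parity_is true J -> (J \o J)%VF = - \1%VF ->
  queer_basis J queer_even (queer_odd J).
Proof.
move=> /parity_isP oJ JJ.
have JJv v : J (J v) = - v.
  by rewrite -comp_lfunE JJ opp_lfunE id_lfunE.
have be : basis_of (spart V false) queer_even := vbasisP _.
have bf : basis_of (spart V true) (queer_odd J).
  have -> : spart V true = ((- J) @: spart V false)%VS.
    apply/eqP; rewrite eqEsubv; apply/andP; split; apply/subvP => v.
      move=> vt; have -> : v = (- J) (J v) by rewrite opp_lfunE JJv opprK.
      by apply: memv_img; apply: (oJ true).
    by case/memv_imgP => u uf ->; rewrite opp_lfunE memvN; apply: (oJ false).
  have -> : tval (queer_odd J) = map (- J)%R queer_even.
    by apply: eq_map => v; rewrite opp_lfunE.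
  apply: limg_basis_of => //; apply/eqP; rewrite -subv0; apply/subvP => v.
  rewrite memv_cap memv_ker opp_lfunE oppr_eq0 => /andP[_ /eqP Jv].
  by rewrite memv0 -oppr_eq0 -JJv Jv linear0.
apply/and3P; split=> //; apply/eqP/matrixP => i j.
have fE (k : 'I_(\dim (spart V false))) : (queer_odd J)`_k = - J queer_even`_k.
  by rewrite (nth_map 0) // size_tuple.
have eE (k : 'I_(\dim (spart V false))) : queer_even`_k = J (queer_odd J)`_k.
  by rewrite fE (linearN J) /= JJv opprK.
have em (k : 'I_(\dim (spart V false))) : queer_even`_k \in spart V false.
  by apply: (basis_mem be); rewrite mem_nth // size_tuple.
have fm (k : 'I_(\dim (spart V false))) : (queer_odd J)`_k \in spart V true.
  by apply: (basis_mem bf); rewrite mem_nth // size_tuple.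
rewrite [LHS]mxE; case: (splitP j) => j' jE.
  have {j jE} -> : j = lshift _ j' by apply: val_inj.
  rewrite nth_catl -[J _]opprK -fE.
  case: (splitP i) => i' iE.
    have {i iE} -> : i = lshift _ i' by apply: val_inj.
    rewrite (proj1 (coord_cat _ _ be bf)) block_mxEul mxE sproj_0 ?linear0 //.
    by rewrite memvN fm.
  have {i iE} -> : i = rshift _ i' by apply: val_inj.
  rewrite (proj2 (coord_cat _ _ be bf)) block_mxEdl !mxE sproj_id ?memvN ?fm //.
  by rewrite linearN /= coord_free ?(basis_free bf) // eq_sym.
have {j jE} -> : j = rshift _ j' by apply: val_inj.
rewrite nth_catr -eE.
case: (splitP i) => i' iE.
  have {i iE} -> : i = lshift _ i' by apply: val_inj.
  rewrite (proj1 (coord_cat _ _ be bf)) block_mxEur mxE sproj_id ?em //.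
  by rewrite coord_free ?(basis_free be) // eq_sym.
have {i iE} -> : i = rshift _ i' by apply: val_inj.
by rewrite (proj2 (coord_cat _ _ be bf)) block_mxEdr mxE sproj_0 ?linear0 // em.
Qed.

Lemma tr_basis_indep (U : {vspace V}) m n (e : m.-tuple V) (f : n.-tuple V)
    (F : {linear V -> V}) :
  basis_of U e -> basis_of U f -> (forall v, F v \in U) ->
  \sum_(i < m) coord e i (F e`_i) = \sum_(i < n) coord f i (F f`_i).
Proof.
move=> be bf FU.
transitivity (\sum_(i < m) \sum_(j < n) coord f j (F e`_i) * coord e i f`_j).
  apply: eq_bigr => i _.
  rewrite {1}(coord_basis bf (FU e`_i)) linear_sum.
  by apply: eq_bigr => j _; rewrite linearZ.
rewrite exchange_big; apply: eq_bigr => j _ /=.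
have fU : f`_j \in U by apply: (basis_mem bf); rewrite mem_nth // size_tuple.
rewrite {2}(coord_basis be fU) !linear_sum.
by apply: eq_bigr => i _; rewrite !linearZ /= mulrC.
Qed.

Lemma qtr_inE J n (e f : n.-tuple V) X : queer_basis J e f ->
  qtr_in e f X = - \sum_(i < n) coord e i (sproj false (X (J e`_i))).
Proof.
move=> qb; have [be bf _] := and3P qb; rewrite -sumrN; apply: eq_bigr => i _.
rewrite 2![LHS]mxE [LHS]mxE nth_catr (proj1 (coord_cat _ _ be bf)).
by have [_ ->] := queer_basisE qb i; rewrite !linearN opprK.
Qed.

Lemma qtrE J n (e f : n.-tuple V) X :
  parity_is true J -> (J \o J)%VF = - \1%VF -> queer_basis J e f ->
  qtr J X = qtr_in e f X.
Proof.
move=> oJ JJ qb; have qb0 := queer_basisP oJ JJ.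
rewrite /qtr (qtr_inE _ qb) (qtr_inE _ qb0); congr (- _).
have [[be _ _] [be0 _ _]] := (and3P qb, and3P qb0).
have E k (g : k.-tuple V) : \sum_(i < k) coord g i (sproj false (X (J g`_i))) =
    \sum_(i < k) coord g i ((sproj false \o X \o J)%VF g`_i).
  by apply: eq_bigr => i _; rewrite !comp_lfunE.
rewrite !E; apply: tr_basis_indep be0 be _ => v.
by rewrite /= !comp_lfunE sproj_mem.
Qed.

Definition sqalg J : {vspace 'End(V)} :=
  (qalg J :&: lker (linfun (qtr J : 'End(V) -> K^o)))%VS.

Lemma mem_sqalg J X : (X \in sqalg J) = (sbr X J == 0) && (qtr J X == 0).
Proof. by rewrite memv_cap mem_qalg memv_ker lfunE. Qed.

Definition is_lie_subsuperalgebra (h : {vspace 'End(V)}) : Prop :=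
  (forall a X, X \in h -> hcomp a X \in h) /\
  (forall X Y, X \in h -> Y \in h -> sbr X Y \in h).

Definition maximal_in (g L : {vspace 'End(V)}) : Prop :=
  [/\ is_lie_subsuperalgebra g, (g <= L)%VS, g <> L &
      forall h : {vspace 'End(V)}, is_lie_subsuperalgebra h ->
        (g <= h)%VS -> (h <= L)%VS -> h = g \/ h = L].

End Operators.

Section TensorSpace.
Variables (K : fieldType) (V1 V2 : vectType K).

(* V1 (x) V2, realized on coordinates: M stands for the sum of the
   M i j *: (e_i (x) f_j), where e and f are the chosen bases of V1 and V2.
   [tliftE] and [tens_ext] are the universal property. *)
Definition tspace : vectType K := 'M[K]_(\dim {:V1}, \dim {:V2}).

Definition tens (v : V1) (w : V2) : tspace :=
  \matrix_(i, j) (coord (vbasis {:V1}) i v * coord (vbasis {:V2}) j w).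

Lemma tens_linearl w : linear (tens^~ w).
Proof. by move=> k v v'; apply/matrixP => i j; rewrite !mxE linearP mulrDl mulrA. Qed.

Lemma tens_linearr v : linear (tens v).
Proof.
move=> k w w'; apply/matrixP => i j.
by rewrite !mxE linearP mulrDr mulrCA.
Qed.

Section Lift.
Variables (W : vectType K) (b : V1 -> V2 -> W).

Definition tlift_fun (M : tspace) : W :=
  \sum_i \sum_j M i j *: b (vbasis {:V1})`_i (vbasis {:V2})`_j.

Lemma tlift_linear : linear tlift_fun.
Proof.
move=> k M N; rewrite /tlift_fun scaler_sumr -big_split; apply: eq_bigr => i _ /=.
rewrite scaler_sumr -big_split; apply: eq_bigr => j _ /=.
by rewrite !mxE scalerDl scalerA.
Qed.
HB.instance Definition _ := GRing.isLinear.Build K tspace W _ tlift_fun tlift_linear.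

(* The linear map on V1 (x) V2 induced by the bilinear map b. *)
Definition tlift : 'Hom(tspace, W) := linfun tlift_fun.

Lemma tliftE v w :
  (forall w', linear (b^~ w')) -> (forall v', linear (b v')) ->
  tlift (tens v w) = b v w.
Proof.
move=> bl br; rewrite lfunE /= /tlift_fun.
pose bl' w' : {linear V1 -> W} :=
  HB.pack (b^~ w') (GRing.isLinear.Build K V1 W _ (b^~ w') (bl w')).
pose br' v' : {linear V2 -> W} :=
  HB.pack (b v') (GRing.isLinear.Build K V2 W _ (b v') (br v')).
rewrite [in RHS](coord_vbasis (memvf v)).
rewrite -[RHS]/(bl' w _) linear_sum; apply: eq_bigr => i _.
rewrite linearZ /= {2}(coord_vbasis (memvf w)).
rewrite -[b _ _]/(br' _ _) linear_sum scaler_sumr; apply: eq_bigr => j _.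
by rewrite linearZ /= mxE scalerA.
Qed.

End Lift.

Lemma tens_basis (i : 'I_(\dim {:V1})) (j : 'I_(\dim {:V2})) :
  tens (vbasis {:V1})`_i (vbasis {:V2})`_j = delta_mx i j.
Proof.
apply/matrixP => k l; rewrite !mxE !coord_free ?(basis_free (vbasisP _)) //.
by rewrite -natrM mulnb !(eq_sym _ k) !(eq_sym _ l).
Qed.

Lemma tens_ext (W : vectType K) (f g : 'Hom(tspace, W)) :
  (forall v w, f (tens v w) = g (tens v w)) -> f = g.
Proof.
move=> fg; apply/lfunP => M.
rewrite [M in LHS]matrix_sum_delta [M in RHS]matrix_sum_delta !linear_sum.
apply: eq_bigr => i _; rewrite !linear_sum; apply: eq_bigr => j _.
by rewrite !linearZ /= -tens_basis fg.
Qed.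

Definition tens_span (U : {vspace V1}) (W : {vspace V2}) : {vspace tspace} :=
  <<[seq tens u w | u <- vbasis U, w <- vbasis W]>>%VS.

Lemma tens_mem (U : {vspace V1}) (W : {vspace V2}) u w :
  u \in U -> w \in W -> tens u w \in tens_span U W.
Proof.
pose tl w' : {linear V1 -> tspace} :=
  HB.pack (tens^~ w') (GRing.isLinear.Build K V1 tspace _ (tens^~ w') (tens_linearl w')).
pose tr v' : {linear V2 -> tspace} :=
  HB.pack (tens v') (GRing.isLinear.Build K V2 tspace _ (tens v') (tens_linearr v')).
move=> uU wW; rewrite (coord_vbasis uU) -[tens _ _]/(tl w _) linear_sum.
apply: memv_suml => i _; rewrite linearZ /=; apply: memvZ.
rewrite (coord_vbasis wW) -[tens _ _]/(tr _ _) linear_sum.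
apply: memv_suml => j _; rewrite linearZ /=; apply: memvZ.
by apply: memv_span; apply/allpairsP; exists ((vbasis U)`_i, (vbasis W)`_j);
   rewrite !mem_nth ?size_tuple.
Qed.

Lemma tens_span_ind (U : {vspace V1}) (W : {vspace V2}) (S : {vspace tspace}) :
  (forall u w, u \in U -> w \in W -> tens u w \in S) -> (tens_span U W <= S)%VS.
Proof.
move=> h; apply/span_subvP => _ /allpairsP[[u w] [/= uU wW ->]].
by apply: h; apply: vbasis_mem.
Qed.

End TensorSpace.

Section TensorSuper.
Variables (K : fieldType) (V1 V2 : superspace K).

Definition tpart (c : bool) : {vspace tspace V1 V2} :=
  (\sum_(a : bool) tens_span (spart V1 a) (spart V2 (a (+) c)))%VS.

Lemma tens_tpart a b v w :
  v \in spart V1 a -> w \in spart V2 b -> tens v w \in tpart (a (+) b).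
Proof.
move=> va wb; rewrite /tpart (bigD1 a) //= addbA addbb /=.
by apply: (subvP (addvSl _ _)); apply: tens_mem.
Qed.

Lemma tpart_ind c (S : {vspace tspace V1 V2}) :
  (forall a v w, v \in spart V1 a -> w \in spart V2 (a (+) c) -> tens v w \in S) ->
  (tpart c <= S)%VS.
Proof. by move=> h; apply/subv_sumP => a _; apply: tens_span_ind; apply: h. Qed.

Lemma tens_sproj v w :
  tens v w = \sum_(a : bool) \sum_(b : bool) tens (sproj V1 a v) (sproj V2 b w).
Proof.
have tD1 x x' y : tens (V1 := V1) (V2 := V2) (x + x') y = tens x y + tens x' y.
  by have := tens_linearl y 1 x x'; rewrite !scale1r.
have tD2 x y y' : tens (V1 := V1) (V2 := V2) x (y + y') = tens x y + tens x y'.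
  by have := tens_linearr x 1 y y'; rewrite !scale1r.
by rewrite !big_bool /= -!tD2 -tD1 ![sproj _ true _ + _]addrC !sproj_sum.
Qed.

Lemma tpart_add : (tpart false + tpart true)%VS = fullv.
Proof.
apply/eqP; rewrite eqEsubv subvf /=; apply/subvP => M _.
rewrite [M]matrix_sum_delta.
apply: memv_suml => i _; apply: memv_suml => j _; apply: memvZ.
rewrite -tens_basis tens_sproj.
apply: memv_suml => a _; apply: memv_suml => b _.
have := tens_tpart (sproj_mem a (vbasis {:V1})`_i) (sproj_mem b (vbasis {:V2})`_j).
by case: (a (+) b); apply/subvP; [exact: addvSr | exact: addvSl].
Qed.

Let otens (X : 'End(V1)) (Y : 'End(V2)) : 'End(tspace V1 V2) :=
  tlift (fun v w => tens (X v) (Y w)).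

Let otensE X Y v w : otens X Y (tens v w) = tens (X v) (Y w).
Proof.
rewrite tliftE // => [w' k x x'|v' k x x']; rewrite linearP.
  exact: tens_linearl.
exact: tens_linearr.
Qed.

Let tproj : 'End(tspace V1 V2) :=
  \sum_(a : bool) otens (sproj V1 a) (sproj V2 a).

Let tens0l w : tens (0 : V1) w = 0 :> tspace V1 V2.
Proof. by apply/matrixP => i j; rewrite !mxE linear0 mul0r. Qed.

Let tens0r v : tens v (0 : V2) = 0 :> tspace V1 V2.
Proof. by apply/matrixP => i j; rewrite !mxE linear0 mulr0. Qed.

Let tproj_tens a c v w : v \in spart V1 a -> w \in spart V2 (a (+) c) ->
  tproj (tens v w) = if c then 0 else tens v w.
Proof.
rewrite /tproj big_bool /= add_lfunE !otensE; case: a c => [] [] /= va wb.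
- by rewrite (sproj_0 (a := true) wb) (sproj_0 (a := false) va) tens0l tens0r addr0.
- by rewrite (sproj_id va) (sproj_id wb) (sproj_0 (a := false) va) tens0l addr0.
- by rewrite (sproj_0 (a := true) va) (sproj_0 (a := false) wb) tens0l tens0r addr0.
- by rewrite (sproj_id va) (sproj_id wb) (sproj_0 (a := true) va) tens0l add0r.
Qed.

Lemma tpart_cap : (tpart false :&: tpart true)%VS = 0%VS.
Proof.
apply/eqP; rewrite -subv0; apply/subvP => M /memv_capP[M0 M1].
have h1 : (tpart true <= lker tproj)%VS.
  by apply: tpart_ind => a v w va wa; rewrite memv_ker (tproj_tens va wa).
have h0 : (tpart false <= lker (tproj - \1)%VF)%VS.
  apply: tpart_ind => a v w va wa.
  by rewrite memv_ker add_lfunE opp_lfunE id_lfunE (tproj_tens va wa) subrr.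
have /eqP e1 : tproj M == 0 by rewrite -memv_ker (subvP h1).
have : M \in lker (tproj - \1)%VF by rewrite (subvP h0).
by rewrite memv_ker add_lfunE opp_lfunE id_lfunE e1 sub0r oppr_eq0 memv0.
Qed.

Definition stensor : superspace K := SuperSpace tpart_add tpart_cap.

(* (X (x) Y) (v (x) w) = (-1)^(p(Y) p(v)) (X v) (x) (Y w). *)
Definition otimes_fun (X : 'End(V1)) (Y : 'End(V2)) (v : V1) (w : V2) :
    tspace V1 V2 :=
  \sum_(a : bool) \sum_(b : bool)
    (-1) ^+ (a && b) *: tens (X (sproj V1 a v)) (hcomp b Y w).

Definition otimes (X : 'End(V1)) (Y : 'End(V2)) : 'End(stensor) :=
  tlift (otimes_fun X Y).

Lemma otimes_tens X Y v w : otimes X Y (tens v w) = otimes_fun X Y v w.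
Proof.
rewrite tliftE // => [w' k x x' | v' k x x']; rewrite /otimes_fun.
  rewrite scaler_sumr -big_split; apply: eq_bigr => a _ /=.
  rewrite scaler_sumr -big_split; apply: eq_bigr => b _ /=.
  by rewrite !linearP tens_linearl scalerDr !scalerA mulrC.
rewrite scaler_sumr -big_split; apply: eq_bigr => a _ /=.
rewrite scaler_sumr -big_split; apply: eq_bigr => b _ /=.
by rewrite !linearP tens_linearr scalerDr !scalerA mulrC.
Qed.

Lemma otimesE a b X Y v w : v \in spart V1 a -> parity_is b Y ->
  otimes X Y (tens v w) = (-1) ^+ (a && b) *: tens (X v) (Y w).
Proof.
move=> va hY; rewrite otimes_tens /otimes_fun.
rewrite (bigD1 a) //= [X in _ + X]big1 ?addr0; last first.
  move=> a' na; rewrite (sproj_0 (a := a')); last first.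
    by have -> : ~~ a' = a by case: a' a na {va} => [] [].
  by rewrite big1 // => b' _; rewrite linear0 tens0l scaler0.
rewrite (bigD1 b) //= [X in _ + X]big1 ?addr0; last first.
  move=> b' nb; rewrite (hcomp_0 (X := Y) (a := b')); last first.
    by have -> : ~~ b' = b by case: b' b nb {hY} => [] [].
  by rewrite zero_lfunE tens0r scaler0.
by rewrite (sproj_id va) (hcomp_id hY).
Qed.

Definition otimesl (Y : 'End(V2)) (X : 'End(V1)) := otimes X Y.

Lemma otimes_linearl Y : linear (otimesl Y).
Proof.
move=> k X X'; apply: tens_ext => v w.
rewrite add_lfunE scale_lfunE !otimes_tens /otimes_fun.
rewrite scaler_sumr -big_split; apply: eq_bigr => a _ /=.
rewrite scaler_sumr -big_split; apply: eq_bigr => b _ /=.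
by rewrite add_lfunE scale_lfunE tens_linearl scalerDr !scalerA mulrC.
Qed.
HB.instance Definition _ Y :=
  GRing.isLinear.Build K 'End(V1) 'End(stensor) _ (otimesl Y) (otimes_linearl Y).

Lemma otimes_linearr X : linear (otimes X).
Proof.
move=> k Y Y'; apply: tens_ext => v w.
rewrite add_lfunE scale_lfunE !otimes_tens /otimes_fun.
rewrite scaler_sumr -big_split; apply: eq_bigr => a _ /=.
rewrite scaler_sumr -big_split; apply: eq_bigr => b _ /=.
by rewrite linearP add_lfunE scale_lfunE tens_linearr scalerDr !scalerA mulrC.
Qed.
HB.instance Definition _ X :=
  GRing.isLinear.Build K 'End(V2) 'End(stensor) _ (otimes X) (otimes_linearr X).

(* The image of g1 (+) g2 under X1 + X2 |-> X1 (x) 1 + 1 (x) X2. *)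
Definition odot (g1 : {vspace 'End(V1)}) (g2 : {vspace 'End(V2)}) :
    {vspace 'End(stensor)} :=
  (linfun (otimesl \1%VF) @: g1 + linfun (otimes \1%VF) @: g2)%VS.

Lemma mem_odot g1 g2 X :
  X \in odot g1 g2 <-> exists X1 X2,
    [/\ X1 \in g1, X2 \in g2 & X = otimes X1 \1%VF + otimes \1%VF X2].
Proof.
split.
  case/memv_addP => _ /memv_imgP[X1 h1 ->] [_ /memv_imgP[X2 h2 ->] ->].
  by exists X1, X2; rewrite !lfunE.
case=> X1 [X2 [h1 h2 ->]]; apply: memv_add.
  by apply/memv_imgP; exists X1; rewrite ?lfunE.
by apply/memv_imgP; exists X2; rewrite ?lfunE.
Qed.

End TensorSuper.

(* Main.v *)
From HB Require Import structures.
Require Import Defs.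
From mathcomp Require Import all_boot all_order all_algebra.
From mathcomp Require Import complex reals.
Set Implicit Arguments. Unset Strict Implicit. Unset Printing Implicit Defensive.
Import GRing.Theory.
Local Open Scope ring_scope.

(** Let [Q = qalg J1]. Composing [J1] with the grading operator gives an odd
    [xi] with [xi^2 = 1], and supercommuting with [J1] is the same as commuting
    with [xi] ([qalgP]). So [Q] is an associative superalgebra: a full matrix
    algebra with units [E_ij] in even degree, and [xi] times it in odd degree.
    In a homogeneous basis of [V2] with matrix units [F_kl], every element of
    [qalg J] is a sum of tensors [P_kl (x) F_kl] with [P_kl] in [Q]
    ([otimes_decomp_qalg]), and it lies in [g] exactly when it is of the form
    [P (x) 1 + 1 (x) Y], that is, when all the [P_kl] with [k != l] and all the
    differences [P_kk - P_ll] are scalars.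

    Let [h] be a subsuperalgebra strictly above [g]. Bracketing an element of
    [h] outside [g] with [1 (x) F_kk] and [1 (x) F_kl] isolates in [h] a tensor
    [P (x) F_kl] with [k != l] and [P] non-scalar ([over_nonscalar]). The
    assumption on [N2] says that two distinct basis vectors of [V2], with indices
    [p0] and [q0], have the same parity, and then brackets with [gl(V2)] carry
    [F_kl] to every other off-diagonal unit ([munit_offdiag]). Consider
    the space [S] of the [P] in [Q] with [P (x) F_(p0 q0)] in [h]. It is a Lie
    ideal of [Q], and bracketing [P (x) F_(p0 q0)] with
    [P' (x) (F_(p0 p0) - F_(q0 q0))] shows that it is also closed under
    super-anticommutators, hence under products. A Lie ideal of [Q] which is a
    subalgebra and contains a non-scalar is [Q] ([qalg_gen]), so [S = Q].

    Consequently [h] contains [P (x) F_ij] for [i != j], the combinations of the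
    [P (x) F_ii] of supertrace zero, and [[P, P'] (x) F_(p0 p0)], for all [P],
    [P'] in [Q]. If [m2 != n2], then [P (x) 1] in [h] provides the missing
    [P (x) F_(p0 p0)], because its supertrace is not zero, and [h = qalg J]. If
    [m2 = n2], then [h] has codimension at most one in [qalg J], because
    [[Q, Q]] has codimension at most one in [Q] ([qalg_comm]); as [h] lies
    in the kernel [sqalg J] of the queer trace, which is not zero on [qalg J], it
    is equal to that kernel.

    The queer trace kills all brackets in [qalg J] ([qtr_sbr]), which gives
    [g <= sqalg J] when [m2 = n2]; and [g] is proper since it misses
    [xi (x) F_(p0 q0)]. *)

(** * Matrix units and corners of endomorphism algebras *)

Lemma sum_delta2 (K : pzRingType) (W : lmodType K) (I : finType) (G : I -> I -> W) k l :
  \sum_i \sum_j ((i == k) && (j == l))%:R *: G i j = G k l.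
Proof.
rewrite (bigD1 k) //= [X in _ + X]big1 ?addr0 => [|i /negPf ik].
  rewrite (bigD1 l) //= big1 ?addr0 => [|j /negPf jl]; first by rewrite !eqxx scale1r.
  by rewrite jl andbF scale0r.
by rewrite big1 // => j _; rewrite ik scale0r.
Qed.

Section MatrixUnits.
Variables (K : fieldType) (W : vectType K).

Lemma comp_lfun_sumr I (r : seq I) (P : pred I) (F : I -> 'End(W)) (X : 'End(W)) :
  (X \o (\sum_(i <- r | P i) F i) = \sum_(i <- r | P i) (X \o F i))%VF.
Proof.
by apply: (big_morph (comp_lfun X)) => [Y Z|]; rewrite ?comp_lfunDr ?comp_lfun0r.
Qed.

Lemma comp_lfun_suml I (r : seq I) (P : pred I) (F : I -> 'End(W)) (X : 'End(W)) :
  ((\sum_(i <- r | P i) F i) \o X = \sum_(i <- r | P i) (F i \o X))%VF.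
Proof.
by elim/big_rec2: _ => [|i Y Z _ <-]; rewrite ?comp_lfun0l ?comp_lfunDl.
Qed.

(** Commutators alone cut the corner [e X f] out of [X]: bracketing with [f] and
    then [e] leaves [- (e X f + f X e)], one more bracket with [f] changes the
    relative sign, and the sum of the two results is [- 2 e X f]. *)
Lemma corner_mem (U : {vspace 'End(W)}) (e f X : 'End(W)) :
  2%:R != 0 :> K ->
  (e \o e = e)%VF -> (f \o f = f)%VF -> (e \o f = 0)%VF -> (f \o e = 0)%VF ->
  (forall Y, Y \in U -> (Y \o e)%VF - (e \o Y)%VF \in U) ->
  (forall Y, Y \in U -> (Y \o f)%VF - (f \o Y)%VF \in U) ->
  X \in U -> (e \o X \o f)%VF \in U.
Proof.
move=> n2 ee ff ef fe adE adF XU; pose M := comp_lfunA.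
have := adE _ (adF _ XU).
set A := (f \o X \o e)%VF; set B := (e \o X \o f)%VF.
have -> : (((X \o f)%VF - (f \o X)%VF) \o e)%VF -
    (e \o ((X \o f)%VF - (f \o X)%VF))%VF = - A - B.
  rewrite !(comp_lfunDl, comp_lfunDr, comp_lfunNl, comp_lfunNr).
  by rewrite -(M _ _ _ _ _ X f e) fe !M ef !(comp_lfun0l, comp_lfun0r) oppr0 addr0 add0r.
move=> ABU; have := adF _ ABU.
have -> : ((- A - B) \o f)%VF - (f \o (- A - B))%VF = A - B.
  rewrite !(comp_lfunDl, comp_lfunDr, comp_lfunNl, comp_lfunNr) {1 2}/A {1 2}/B.
  rewrite -(M _ _ _ _ _ _ e f) ef -(M _ _ _ _ _ _ f f) ff !M ff fe.
  by rewrite !(comp_lfun0l, comp_lfun0r) oppr0 add0r addr0 opprK addrC.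
move=> /(memvD ABU); rewrite addrACA addNr add0r -opprD memvN -mulr2n -scaler_nat.
by move=> /(memvZ 2%:R^-1); rewrite scalerA mulVf // scale1r.
Qed.

Definition rank1_fun (f : {scalar W}) (u v : W) : W := f v *: u.

Lemma rank1_linear f u : linear (rank1_fun f u).
Proof. by move=> k v v'; rewrite /rank1_fun linearP scalerDl scalerA. Qed.
HB.instance Definition _ f u :=
  GRing.isLinear.Build K W W _ (rank1_fun f u) (rank1_linear f u).

Variables (d : nat) (w : d.-tuple W).

Definition munit (i j : 'I_d) : 'End(W) := linfun (rank1_fun (coord w j) w`_i).

Lemma munitE i j v : munit i j v = coord w j v *: w`_i.
Proof. by rewrite lfunE. Qed.

Lemma munit_mul i j k l : free w ->
  (munit i j \o munit k l)%VF = (j == k)%:R *: munit i l.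
Proof.
move=> fw; apply/lfunP => v.
by rewrite comp_lfunE scale_lfunE !munitE linearZ /= coord_free // scalerA mulrC eq_sym.
Qed.

Hypothesis bw : basis_of fullv w.

Lemma munit_decomp (X : 'End(W)) :
  X = \sum_(i < d) \sum_(j < d) coord w i (X w`_j) *: munit i j.
Proof.
apply/lfunP => v; rewrite exchange_big sum_lfunE.
rewrite {1}(coord_basis bw (memvf v)) linear_sum; apply: eq_bigr => j _.
rewrite linearZ /= sum_lfunE {1}(coord_basis bw (memvf (X w`_j))) scaler_sumr.
by apply: eq_bigr => i _; rewrite scale_lfunE munitE !scalerA mulrC.
Qed.

Lemma munit_sum1 : \sum_i munit i i = \1%VF.
Proof.
apply/lfunP => v; rewrite sum_lfunE id_lfunE [RHS](coord_basis bw (memvf v)).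
by apply: eq_bigr => i _; rewrite munitE.
Qed.

End MatrixUnits.

(** * Parities and the supercommutator *)

Section Superspace.
Variables (K : fieldType) (V : superspace K).
Implicit Types (X Y Z : 'End(V)) (a b : bool).

Lemma parity_is1 : parity_is false (\1%VF : 'End(V)).
Proof. by apply/parity_isP => b v vb; rewrite id_lfunE. Qed.

Lemma parity_is_comp a b X Y :
  parity_is a X -> parity_is b Y -> parity_is (a (+) b) (X \o Y)%VF.
Proof.
move=> /parity_isP pX /parity_isP pY; apply/parity_isP => c v vc.
by rewrite comp_lfunE -addbA; apply/pX/pY.
Qed.

Lemma parity_isD a X Y : parity_is a X -> parity_is a Y -> parity_is a (X + Y).
Proof.
move=> /parity_isP pX /parity_isP pY; apply/parity_isP => c v vc.
by rewrite add_lfunE memvD ?pX ?pY.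
Qed.

Lemma parity_isB a X Y : parity_is a X -> parity_is a Y -> parity_is a (X - Y).
Proof.
move=> /parity_isP pX /parity_isP pY; apply/parity_isP => c v vc.
by rewrite add_lfunE opp_lfunE memvB ?pX ?pY.
Qed.

Lemma homogeneous_ext X Y : (forall a v, v \in spart V a -> X v = Y v) -> X = Y.
Proof.
move=> XY; apply/lfunP => v; rewrite -[v]sproj_sum !linearD /=.
by rewrite (XY _ _ (sproj_mem false v)) (XY _ _ (sproj_mem true v)).
Qed.

Lemma sbr_linearr X : linear (@sbr K V X).
Proof.
move=> k Y Y'; rewrite /sbr scaler_sumr -big_split; apply: eq_bigr => a _ /=.
rewrite scaler_sumr -big_split; apply: eq_bigr => b _ /=.
rewrite linearD linearZ /= comp_lfunDl comp_lfunDr -comp_lfunZl -comp_lfunZr.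
by rewrite scalerDr scalerBr opprD !scalerA [k * _]mulrC addrACA.
Qed.
HB.instance Definition _ X :=
  GRing.isLinear.Build K 'End(V) 'End(V) _ (@sbr K V X) (sbr_linearr X).

Lemma sbrDl X X' Y : sbr (X + X') Y = sbr X Y + sbr X' Y.
Proof. exact: (linearD (@sbrr K V Y)). Qed.

Lemma sbrZl k X Y : sbr (k *: X) Y = k *: sbr X Y.
Proof. exact: (linearZZ (@sbrr K V Y)). Qed.

Lemma sbr_suml I (r : seq I) (P : pred I) (G : I -> 'End(V)) Y :
  sbr (\sum_(i <- r | P i) G i) Y = \sum_(i <- r | P i) sbr (G i) Y.
Proof. exact: (linear_sum (@sbrr K V Y)). Qed.

Lemma sbrDr X Y Y' : sbr X (Y + Y') = sbr X Y + sbr X Y'.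
Proof. exact: (linearD (@sbr K V X)). Qed.

(** Against an even operator the supercommutator has no sign, whatever the
    other operator, homogeneous or not. *)
Lemma sbr_evenr X Y : parity_is false Y -> sbr X Y = (X \o Y)%VF - (Y \o X)%VF.
Proof.
move=> eY; rewrite -[X]hcomp_sum sbrDl.
rewrite !(sbrE (hcomp_parity _ _) eY) !andbF expr0 !scale1r.
by rewrite comp_lfunDl comp_lfunDr opprD addrACA.
Qed.

Lemma sbr_evenl X Y : parity_is false X -> sbr X Y = (X \o Y)%VF - (Y \o X)%VF.
Proof.
move=> eX; rewrite -[Y]hcomp_sum linearD /=.
rewrite !(sbrE eX (hcomp_parity _ _)) /= expr0 !scale1r.
by rewrite comp_lfunDl comp_lfunDr opprD addrACA.
Qed.

Lemma sbr_odd X Y : parity_is true X -> parity_is true Y ->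
  sbr X Y = (X \o Y)%VF + (Y \o X)%VF.
Proof. by move=> oX oY; rewrite (sbrE oX oY) expr1 scaleN1r opprK. Qed.

Lemma parity_isZ a k X : parity_is a X -> parity_is a (k *: X).
Proof.
by move=> /parity_isP pX; apply/parity_isP => c v vc; rewrite scale_lfunE memvZ ?pX.
Qed.

Lemma parity_is_sbr a b X Y :
  parity_is a X -> parity_is b Y -> parity_is (a (+) b) (sbr X Y).
Proof.
move=> pX pY; rewrite (sbrE pX pY).
apply: parity_isB; first exact: parity_is_comp.
by apply: parity_isZ; rewrite addbC; apply: parity_is_comp.
Qed.

Lemma parity_is_hcomp a b X : parity_is a X -> a != b -> hcomp b X = 0.
Proof. by move=> pX nab; apply: hcomp_0; case: a b pX nab => [] []. Qed.

End Superspace.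

(** * The queer superalgebra *)

Section Queer.
Variables (K : fieldType) (V : superspace K) (J : 'End(V)).
Implicit Types (X Y Z : 'End(V)) (a b : bool).

Definition sgrade : 'End(V) := locked (sproj V false - sproj V true).
(** The odd square root of [1] whose ungraded centralizer is [qalg J]. *)
Definition qxi : 'End(V) := locked (J \o sgrade)%VF.

Lemma sgradeE a v : v \in spart V a -> sgrade v = (-1) ^+ a *: v.
Proof.
rewrite /sgrade -lock add_lfunE opp_lfunE; case: a => va; rewrite ?expr1 ?expr0 (sproj_id va).
  by rewrite (sproj_0 (a := false)) // sub0r scaleN1r.
by rewrite (sproj_0 (a := true)) // subr0 scale1r.
Qed.

Lemma sgrade_sq : (sgrade \o sgrade = \1)%VF.
Proof.
apply: homogeneous_ext => a v va; rewrite comp_lfunE (sgradeE va) linearZ /= (sgradeE va).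
by rewrite id_lfunE scalerA -expr2 sqrr_sign scale1r.
Qed.

Lemma qxiE a v : v \in spart V a -> qxi v = (-1) ^+ a *: J v.
Proof. by move=> va; rewrite /qxi -lock comp_lfunE (sgradeE va) linearZ. Qed.

Hypotheses (oJ : parity_is true J) (JJ : (J \o J)%VF = - \1%VF).

Lemma queerJK v : J (J v) = - v.
Proof. by rewrite -comp_lfunE JJ opp_lfunE id_lfunE. Qed.

Lemma qxi_odd : parity_is true qxi.
Proof.
by apply/parity_isP => a v va; rewrite (qxiE va) memvZ // (parity_isP _ _ oJ).
Qed.

Lemma qxi_sq : (qxi \o qxi)%VF = \1%VF.
Proof.
apply: homogeneous_ext => a v va; rewrite comp_lfunE (qxiE va) linearZ /=.
rewrite (qxiE (parity_isP _ _ oJ _ _ va)) queerJK id_lfunE scalerA.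
by case: a va => _; rewrite ?(expr1, expr0, mulN1r, mul1r, opprK, scale1r, scaleN1r).
Qed.

(** Up to the invertible grading operator, the supercommutator with [J] is the
    plain commutator with [qxi]. This makes [qalg J] visibly closed under
    products. *)
Lemma qalgP X : reflect (X \o qxi = qxi \o X)%VF (X \in qalg J).
Proof.
have Eh b Y : parity_is b Y ->
    (Y \o qxi)%VF - (qxi \o Y)%VF = (sbr Y J \o sgrade)%VF.
  move=> pY; apply: homogeneous_ext => a v va.
  rewrite (sbrE pY oJ) !(add_lfunE, opp_lfunE, comp_lfunE, scale_lfunE).
  rewrite (sgradeE va) (qxiE va) (qxiE (parity_isP _ _ pY _ _ va)) !linearZ /=.
  by rewrite andbT !scalerA signr_addb.
have E : (X \o qxi)%VF - (qxi \o X)%VF = (sbr X J \o sgrade)%VF.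
  rewrite -[X]hcomp_sum sbrDl !(comp_lfunDl, comp_lfunDr) opprD addrACA.
  by rewrite !(Eh _ _ (hcomp_parity _ _)).
rewrite mem_qalg; apply: (iffP eqP) => [X0 | XJ].
  by apply/eqP; rewrite -subr_eq0 E X0 comp_lfun0l.
move/eqP: E; rewrite XJ subrr eq_sym => /eqP E.
by rewrite -[sbr X J]comp_lfun1r -sgrade_sq comp_lfunA E comp_lfun0l.
Qed.

Lemma qalg1 : \1%VF \in qalg J.
Proof. by apply/qalgP; rewrite comp_lfun1l comp_lfun1r. Qed.

Lemma qalg_xi : qxi \in qalg J. Proof. exact/qalgP. Qed.

Lemma qalgM X Y : X \in qalg J -> Y \in qalg J -> (X \o Y)%VF \in qalg J.
Proof.
move=> /qalgP Xc /qalgP Yc; apply/qalgP.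
by rewrite -comp_lfunA Yc !comp_lfunA Xc.
Qed.

(** The components of [X] bracket with [J] into opposite parities, so the two
    brackets vanish separately. *)
Lemma qalg_hcomp a X : X \in qalg J -> hcomp a X \in qalg J.
Proof.
rewrite !mem_qalg => /eqP X0.
have h b := parity_is_sbr (hcomp_parity b X) oJ.
have E : sbr X J = sbr (hcomp false X) J + sbr (hcomp true X) J.
  by rewrite -sbrDl hcomp_sum.
rewrite -[sbr _ J](hcomp_id (h a)).
have -> : hcomp (a (+) true) (sbr (hcomp a X) J) = hcomp (a (+) true) (sbr X J).
  rewrite E [RHS]linearD /=; case: a => /=.
    by rewrite [X in X + _](parity_is_hcomp (h false)) // add0r.
  by rewrite [X in _ + X](parity_is_hcomp (h true)) // addr0.
by rewrite X0 linear0.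
Qed.

Lemma qalg_sbr X Y : X \in qalg J -> Y \in qalg J -> sbr X Y \in qalg J.
Proof.
move=> XQ YQ; apply: memv_suml => a _; apply: memv_suml => b _.
by rewrite memvB ?memvZ // qalgM // qalg_hcomp.
Qed.

Let n := \dim (spart V false).
Let e : n.-tuple V := queer_even V.
Let be : basis_of (spart V false) e := vbasisP _.

Let e_even (i : 'I_n) : e`_i \in spart V false.
Proof. by rewrite (basis_mem be) // mem_nth // size_tuple. Qed.

Definition qunit_half (i j : 'I_n) : 'End(V) := locked (munit e i j \o sproj V false)%VF.

Lemma qunit_halfE i j v :
  qunit_half i j v = coord e j (sproj V false v) *: e`_i.
Proof. by rewrite /qunit_half -lock comp_lfunE munitE. Qed.

(** A matrix unit of the even part of [V], extended to the odd part through
    [qxi] so that it commutes with [qxi]. *)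
Definition qunit (i j : 'I_n) : 'End(V) :=
  locked (qunit_half i j + (qxi \o qunit_half i j \o qxi)%VF).

Lemma qunitE i j :
  qunit i j = qunit_half i j + (qxi \o qunit_half i j \o qxi)%VF.
Proof. by rewrite /qunit -lock. Qed.

Lemma qunit_half_mul i j k l :
  (qunit_half i j \o qunit_half k l)%VF = (j == k)%:R *: qunit_half i l.
Proof.
apply/lfunP => v; rewrite comp_lfunE scale_lfunE !qunit_halfE !linearZ /=.
by rewrite (sproj_id (e_even k)) coord_free ?(basis_free be) // scalerA eq_sym.
Qed.

Lemma qunit_half_xi i j k l : (qunit_half i j \o qxi \o qunit_half k l)%VF = 0.
Proof.
have z : sproj V false (qxi e`_k) = 0.
  by rewrite sproj_0 //; apply: (parity_isP _ _ qxi_odd _ _ (e_even k)).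
by apply/lfunP => v; rewrite !comp_lfunE !qunit_halfE !linearZ /= z linear0 mulr0 scale0r zero_lfunE.
Qed.

Lemma qunit_mul i j k l : (qunit i j \o qunit k l)%VF = (j == k)%:R *: qunit i l.
Proof.
rewrite !qunitE !(comp_lfunDl, comp_lfunDr) !comp_lfunA qunit_half_mul.
rewrite qunit_half_xi comp_lfun0l addr0 -[(_ \o qxi \o qxi)%VF]comp_lfunA qxi_sq comp_lfun1r.
rewrite -!(comp_lfunA qxi) qunit_half_xi comp_lfun0r add0r qunit_half_mul.
by rewrite scalerDr comp_lfunZr !comp_lfunZl.
Qed.

Lemma qunit_even i j : parity_is false (qunit i j).
Proof.
have h : parity_is false (qunit_half i j).
  apply/parity_isP => a v va; rewrite qunit_halfE.
  by case: a va => va; [rewrite sproj_0 // linear0 scale0r mem0v | rewrite memvZ].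
by rewrite qunitE; apply: parity_isD => //; apply: parity_is_comp (parity_is_comp qxi_odd h) qxi_odd.
Qed.

Lemma qunit_qalg i j : qunit i j \in qalg J.
Proof.
apply/qalgP; rewrite qunitE comp_lfunDl comp_lfunDr !comp_lfunA qxi_sq comp_lfun1l.
by rewrite -[(_ \o qxi \o qxi)%VF]comp_lfunA qxi_sq comp_lfun1r addrC.
Qed.

(** An even element of [qalg J] is determined by its restriction to the even
    part, which can be any operator there. *)
Lemma qunit_decomp X : X \in qalg J -> parity_is false X ->
  X = \sum_(i < n) \sum_(j < n) coord e i (X e`_j) *: qunit i j.
Proof.
move=> /qalgP Xxi /parity_isP eX.
have p0 : (X \o sproj V false)%VF = \sum_(i < n) \sum_(j < n) coord e i (X e`_j) *: qunit_half i j.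
  apply/lfunP => v; rewrite exchange_big comp_lfunE sum_lfunE.
  rewrite {1}(coord_basis be (sproj_mem false v)) linear_sum; apply: eq_bigr => j _.
  rewrite linearZ /= sum_lfunE {1}(coord_basis be (eX false _ (e_even j))) scaler_sumr.
  apply: eq_bigr => i _.
  by rewrite scale_lfunE qunit_halfE !scalerA mulrC.
have p1 : (qxi \o sproj V false \o qxi)%VF = sproj V true.
  apply: homogeneous_ext => a v va; rewrite !comp_lfunE.
  have xv := parity_isP _ _ qxi_odd _ _ va.
  case: a va xv => va xv; last by rewrite !sproj_0 // linear0.
  by rewrite !sproj_id // -comp_lfunE qxi_sq id_lfunE.
transitivity ((X \o sproj V false)%VF + (qxi \o (X \o sproj V false) \o qxi)%VF).
  rewrite !comp_lfunA -Xxi -!comp_lfunA [(qxi \o (_ \o _))%VF]comp_lfunA p1 -comp_lfunDr.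
  by apply/lfunP => v; rewrite comp_lfunE add_lfunE sproj_sum.
rewrite p0 comp_lfun_sumr comp_lfun_suml -big_split; apply: eq_bigr => i _ /=.
rewrite comp_lfun_sumr comp_lfun_suml -big_split; apply: eq_bigr => j _ /=.
by rewrite -comp_lfunZr -comp_lfunZl -scalerDr qunitE.
Qed.

Lemma qunit_sum1 : \sum_i qunit i i = \1%VF.
Proof.
rewrite [RHS](qunit_decomp qalg1 (parity_is1 V)); apply: eq_bigr => i _.
rewrite (bigD1 i) //= big1 ?addr0 => [|j /negPf ji];
  by rewrite id_lfunE coord_free ?(basis_free be) // ?eqxx ?ji ?scale1r ?scale0r.
Qed.

(** [qxi] maps the even part of [qalg J] onto the odd part. *)
Lemma qalg_le (S : {vspace 'End(V)}) :
  (forall i j, qunit i j \in S) -> (forall i j, (qxi \o qunit i j)%VF \in S) ->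
  (qalg J <= S)%VS.
Proof.
move=> S0 S1; apply/subvP => X XQ; rewrite -[X]hcomp_sum memvD //.
  rewrite (qunit_decomp (qalg_hcomp false XQ) (hcomp_parity _ _)).
  by apply: memv_suml => i _; apply: memv_suml => j _; rewrite memvZ.
have X1Q := qalg_hcomp true XQ.
have eX := parity_is_comp qxi_odd (hcomp_parity true X).
rewrite -[hcomp _ _]comp_lfun1l -qxi_sq -comp_lfunA.
rewrite (qunit_decomp (qalgM qalg_xi X1Q) eX) comp_lfun_sumr.
apply: memv_suml => i _; rewrite comp_lfun_sumr; apply: memv_suml => j _.
by rewrite -comp_lfunZr memvZ.
Qed.

(** From [E_ij] the Lie ideal reaches [E_ji], products give [E_ii], and [E_ii]
    generates all units; [xi E_ii] is the product of [[xi E_ij, E_ji]] with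
    [E_ii]. *)
Lemma qalg_gen_qunit (S : {vspace 'End(V)}) i j :
  2%:R != 0 :> K ->
  (forall X Y, X \in S -> Y \in S -> (X \o Y)%VF \in S) ->
  (forall X Y, X \in qalg J -> Y \in S -> sbr X Y \in S) ->
  i != j -> qunit i j \in S -> (qalg J <= S)%VS.
Proof.
move=> n2 SM Sad ij Sij.
have h : sbr (qunit j i) (sbr (qunit j i) (qunit i j)) = - 2%:R *: qunit j i.
  rewrite !sbr_evenl ?qunit_even // !(comp_lfunDr, comp_lfunDl, comp_lfunNr, comp_lfunNl).
  rewrite !qunit_mul !eqxx !scale1r !qunit_mul !eqxx (negPf ij).
  by rewrite !scale0r !scale1r sub0r subr0 -opprD -mulr2n scaleNr scaler_nat.
have Sji : qunit j i \in S.
  have := Sad _ _ (qunit_qalg j i) (Sad _ _ (qunit_qalg j i) Sij).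
  rewrite h scaleNr memvN => /(memvZ 2%:R^-1).
  by rewrite scalerA mulVf // scale1r.
have Sii : qunit i i \in S.
  by have := SM _ _ Sij Sji; rewrite qunit_mul eqxx scale1r.
have Sil l : qunit i l \in S.
  have [<- // | il] := eqVneq i l.
  have := Sad _ _ (qunit_qalg i l) Sii; rewrite sbr_evenl ?qunit_even // !qunit_mul.
  by rewrite eqxx eq_sym (negPf il) scale0r scale1r sub0r memvN.
have Ski k : qunit k i \in S.
  have [-> // | ki] := eqVneq k i.
  have := Sad _ _ (qunit_qalg k i) Sii; rewrite sbr_evenl ?qunit_even // !qunit_mul.
  by rewrite eqxx eq_sym (negPf ki) scale0r scale1r subr0.
have xiQ k l : (qxi \o qunit k l)%VF \in qalg J.
  by rewrite qalgM ?qalg_xi ?qunit_qalg.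
have xiC k l : (qunit k l \o qxi = qxi \o qunit k l)%VF.
  exact/qalgP/qunit_qalg.
have Sxi : (qxi \o qunit i i)%VF \in S.
  have := SM _ _ (Sad _ _ (xiQ i j) Sji) Sii.
  rewrite sbr_evenr ?qunit_even // comp_lfunDl comp_lfunNl comp_lfunA xiC.
  rewrite -!comp_lfunA !qunit_mul !eqxx (eq_sym j) (negPf ij) !scale1r scale0r !comp_lfun0r.
  by rewrite oppr0 addr0 qunit_mul eqxx scale1r.
apply: qalg_le => k l.
  by have := SM _ _ (Ski k) (Sil l); rewrite qunit_mul eqxx scale1r.
have := SM _ _ (SM _ _ (Ski k) Sxi) (Sil l).
by rewrite comp_lfunA xiC -!comp_lfunA !qunit_mul !eqxx !scale1r qunit_mul eqxx scale1r.
Qed.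

Lemma qunit_sandwich (X : 'End(V)) i j k l : X \in qalg J -> parity_is false X ->
  (qunit i j \o X \o qunit k l)%VF = coord e j (X e`_k) *: qunit i l.
Proof.
move=> XQ eX; rewrite {1}(qunit_decomp XQ eX) comp_lfun_sumr comp_lfun_suml.
rewrite (bigD1 j) //= [X in _ + X]big1 ?addr0 => [|j' j'j]; last first.
  rewrite comp_lfun_sumr comp_lfun_suml big1 // => k' _.
  by rewrite -comp_lfunZr qunit_mul eq_sym (negPf j'j) scale0r scaler0 comp_lfun0l.
rewrite comp_lfun_sumr comp_lfun_suml (bigD1 k) //= [X in _ + X]big1 ?addr0 => [|k' k'k].
  by rewrite -comp_lfunZr qunit_mul eqxx scale1r -comp_lfunZl qunit_mul eqxx scale1r.
rewrite -comp_lfunZr -comp_lfunZl qunit_mul eqxx scale1r.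
by rewrite qunit_mul (negPf k'k) scale0r scaler0.
Qed.

(** A non-scalar matrix has a non-zero entry off the diagonal or two distinct
    diagonal entries. The corner between the two indices, of the matrix or of its
    bracket with [E_ij], is a non-zero multiple of [E_ij]. *)
Lemma qalg_gen_even (S : {vspace 'End(V)}) (X : 'End(V)) :
  2%:R != 0 :> K ->
  (forall X Y, X \in S -> Y \in S -> (X \o Y)%VF \in S) ->
  (forall X Y, X \in qalg J -> Y \in S -> sbr X Y \in S) ->
  X \in qalg J -> parity_is false X -> X \in S -> X \notin <[\1%VF]>%VS ->
  (qalg J <= S)%VS.
Proof.
move=> n2 SM Sad XQ eX XS nX.
have ad k l Y : Y \in S -> (Y \o qunit k l)%VF - (qunit k l \o Y)%VF \in S.
  move=> YS; have := Sad _ _ (qunit_qalg k l) YS.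
  by rewrite sbr_evenl ?qunit_even // -memvN opprB.
have corner i j Y : i != j -> Y \in S -> (qunit i i \o Y \o qunit j j)%VF \in S.
  move=> ij; apply: (corner_mem n2); rewrite ?qunit_mul ?eqxx ?scale1r //.
  - by rewrite (negPf ij) scale0r.
  - by rewrite eq_sym (negPf ij) scale0r.
  - exact: ad.
  - exact: ad.
pose x i j := coord e i (X e`_j).
have off i j : i != j -> x i j != 0 -> (qalg J <= S)%VS.
  move=> ij xij; apply: (qalg_gen_qunit n2 SM Sad ij).
  have := corner i j X ij XS; rewrite qunit_sandwich // => /(memvZ (x i j)^-1).
  by rewrite scalerA mulVf // scale1r.
have diag i j : i != j -> x i i != x j j -> (qalg J <= S)%VS.
  move=> ij xij; apply: (qalg_gen_qunit n2 SM Sad ij).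
  have := corner i j _ ij (ad i j X XS).
  rewrite comp_lfunDr comp_lfunDl comp_lfunNr comp_lfunNl.
  rewrite !comp_lfunA qunit_mul eqxx scale1r -(comp_lfunA _ (qunit i j)) qunit_mul eqxx scale1r.
  rewrite !qunit_sandwich // -scalerBl => /(memvZ (x i i - x j j)^-1).
  by rewrite scalerA mulVf ?scale1r // subr_eq0.
have [/existsP[i /existsP[j /andP[ij xij]]] | h1] :=
  boolP [exists i, exists j, (i != j) && (x i j != 0)]; first exact: off xij.
have [/existsP[i /existsP[j /andP[ij xij]]] | h2] :=
  boolP [exists i, exists j, (i != j) && (x i i != x j j)]; first exact: diag xij.
have x0 i j : i != j -> x i j = 0.
  move=> ij; apply/eqP; apply: contraR h1 => xij.
  by apply/existsP; exists i; apply/existsP; exists j; rewrite ij.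
have xc i j : x i i = x j j.
  have [-> // | ij] := eqVneq i j; apply/eqP; apply: contraR h2 => xij.
  by apply/existsP; exists i; apply/existsP; exists j; rewrite ij.
case/negP: nX; rewrite (qunit_decomp XQ eX).
case: (pickP 'I_n) => [i0 _ | n0]; last first.
  by rewrite big1 ?mem0v // => i; have := n0 i.
apply/vlineP; exists (x i0 i0); rewrite -qunit_sum1 scaler_sumr.
apply: eq_bigr => i _; rewrite (bigD1 i) //= big1 ?addr0 => [|j ji].
  by rewrite -/(x i i) (xc i i0).
by rewrite -/(x i j) x0 ?scale0r // eq_sym.
Qed.

(** The case of a non-scalar even component is [qalg_gen_even]. Otherwise the
    odd component is [qxi B] with [B] even, and [[qxi, qxi B] = 2 B]. If [B] is
    not a scalar this is again the even case; if it is, then [qxi] itself lies in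
    the ideal, and [[qxi A, qxi] = 2 A] for every even [A]. *)
Lemma qalg_gen (S : {vspace 'End(V)}) (X : 'End(V)) :
  2%:R != 0 :> K ->
  (forall X Y, X \in S -> Y \in S -> (X \o Y)%VF \in S) ->
  (forall a X, X \in S -> hcomp a X \in S) ->
  (forall X Y, X \in qalg J -> Y \in S -> sbr X Y \in S) ->
  X \in qalg J -> X \in S -> X \notin <[\1%VF]>%VS ->
  (qalg J <= S)%VS.
Proof.
move=> n2 SM Sh Sad XQ XS nX.
have [X0 | X0] := boolP (hcomp false X \in <[\1%VF]>%VS); last first.
  by apply: qalg_gen_even X0; rewrite ?qalg_hcomp ?hcomp_parity ?Sh.
pose B := (qxi \o hcomp true X)%VF.
have X1E : hcomp true X = (qxi \o B)%VF by rewrite comp_lfunA qxi_sq comp_lfun1l.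
have BQ : B \in qalg J by rewrite qalgM ?qalg_xi ?qalg_hcomp.
have eB : parity_is false B by apply: parity_is_comp qxi_odd (hcomp_parity _ _).
have half Y : Y + Y \in S -> Y \in S.
  move=> /(memvZ 2%:R^-1); rewrite -mulr2n -scaler_nat scalerA mulVf //.
  by rewrite scale1r.
have BS : B \in S.
  apply: half; have := Sad _ _ qalg_xi (Sh true X XS).
  rewrite sbr_odd ?qxi_odd ?hcomp_parity //.
  by rewrite (qalgP _ (qalg_hcomp true XQ)).
have [/vlineP[c Bc] | nB] := boolP (B \in <[\1%VF]>%VS); last first.
  exact: qalg_gen_even nB.
have c0 : c != 0.
  apply: contraNneq nX => c0; rewrite -[X]hcomp_sum X1E Bc c0 scale0r comp_lfun0r.
  by rewrite addr0.
have xiS : qxi \in S.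
  have := Sh true X XS; rewrite X1E Bc -comp_lfunZr comp_lfun1r.
  by move=> /(memvZ c^-1); rewrite scalerA mulVf // scale1r.
have ES i j : qunit i j \in S.
  apply: half; have xE := qunit_qalg i j.
  have := Sad _ _ (qalgM qalg_xi xE) xiS.
  rewrite sbr_odd ?qxi_odd //; last exact: (parity_is_comp qxi_odd (qunit_even i j)).
  by rewrite -comp_lfunA (qalgP _ xE) !comp_lfunA qxi_sq comp_lfun1l.
by apply: qalg_le => i j; rewrite ?SM ?ES.
Qed.

(** The derived algebra contains every even [A], as [[qxi A, qxi] = 2 A], and
    the [qxi E_ij] with [i != j] and [qxi (E_ii - E_jj)], as brackets of matrix
    units. The [qxi E_ii] are therefore all congruent modulo it. *)
Lemma qalg_comm (i0 : 'I_n) (U : {vspace 'End(V)}) : 2%:R != 0 :> K ->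
  (forall X Y, X \in qalg J -> Y \in qalg J -> sbr X Y \in U) ->
  (qalg J <= U + <[(qxi \o qunit i0 i0)%VF]>)%VS.
Proof.
move=> n2 Us; have xiC k l : (qunit k l \o qxi = qxi \o qunit k l)%VF.
  exact/qalgP/qunit_qalg.
have xiQ k l : (qxi \o qunit k l)%VF \in qalg J.
  by rewrite qalgM ?qalg_xi ?qunit_qalg.
have sub := subvP (addvSl U <[(qxi \o qunit i0 i0)%VF]>).
apply: qalg_le => i j.
  apply: sub; have := Us _ _ (xiQ i j) qalg_xi.
  rewrite sbr_odd ?qxi_odd //; last exact: (parity_is_comp qxi_odd (qunit_even i j)).
  rewrite -comp_lfunA xiC !comp_lfunA qxi_sq comp_lfun1l => /(memvZ 2%:R^-1).
  by rewrite -mulr2n -scaler_nat scalerA mulVf // scale1r.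
have [ij | ij] := eqVneq i j; last first.
  apply: sub; have := Us _ _ (xiQ i j) (qunit_qalg j j).
  rewrite sbr_evenr ?qunit_even // comp_lfunA xiC -!comp_lfunA !qunit_mul eqxx.
  by rewrite eq_sym (negPf ij) scale0r scale1r comp_lfun0r subr0.
rewrite -{}ij -[X in X \in _](subrK (qxi \o qunit i0 i0)%VF).
apply: memv_add (memv_line _).
have := Us _ _ (xiQ i i0) (qunit_qalg i0 i).
by rewrite sbr_evenr ?qunit_even // comp_lfunA xiC -!comp_lfunA !qunit_mul !eqxx !scale1r.
Qed.

(** The queer trace as minus the trace of [X J] on the even part. *)
Lemma qtr_trace X : qtr J X = - \sum_i coord e i (sproj V false (X (J e`_i))).
Proof. exact: qtr_inE (queer_basisP oJ JJ). Qed.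

Lemma qtrP k X Y : qtr J (k *: X + Y) = k * qtr J X + qtr J Y.
Proof. exact: qtr_linear. Qed.

Lemma qtrD X Y : qtr J (X + Y) = qtr J X + qtr J Y.
Proof. by have := qtrP 1 X Y; rewrite scale1r mul1r. Qed.

Lemma qtr0 : qtr J 0 = 0.
Proof. by apply: (addIr (qtr J 0)); rewrite -qtrD !add0r. Qed.

Lemma qtrZ k X : qtr J (k *: X) = k * qtr J X.
Proof. by have := qtrP k X 0; rewrite qtr0 !addr0. Qed.

Lemma qtr_sum I (r : seq I) (P : pred I) (G : I -> 'End(V)) :
  qtr J (\sum_(i <- r | P i) G i) = \sum_(i <- r | P i) qtr J (G i).
Proof. by apply: (big_morph (qtr J)); [exact: qtrD | exact: qtr0]. Qed.

Lemma qtr_even X : parity_is false X -> qtr J X = 0.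
Proof.
move=> /parity_isP eX; rewrite qtr_trace big1 ?oppr0 // => i _.
rewrite sproj_0 ?linear0 //; apply: (eX true).
exact: (parity_isP _ _ oJ _ _ (e_even i)).
Qed.

(** [J] commutes with [Y], so both sides are traces on the even part of products
    of the even operators [X J] and [Y], in the two orders. *)
Lemma qtr_mulC X Y : parity_is true X -> parity_is false Y -> Y \in qalg J ->
  qtr J (X \o Y)%VF = qtr J (Y \o X)%VF.
Proof.
move=> oX eY; rewrite mem_qalg (sbr_evenl _ eY) subr_eq0 => /eqP YJ.
have JY v : Y (J v) = J (Y v) by rewrite -!comp_lfunE YJ.
have eA v : v \in spart V false -> X (J v) \in spart V false.
  by move=> v0; apply: (parity_isP _ _ oX true); apply: (parity_isP _ _ oJ false).
have eY0 := parity_isP _ _ eY false.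
rewrite !qtr_trace; congr (- _).
transitivity (\sum_(i < n) \sum_(j < n) coord e j (Y e`_i) * coord e i (X (J e`_j))).
  apply: eq_bigr => i _; rewrite comp_lfunE JY sproj_id ?eA ?eY0 //.
  rewrite {1}(coord_basis be (eY0 _ (e_even i))) !linear_sum.
  by apply: eq_bigr => j _; rewrite !linearZ.
rewrite exchange_big; apply: eq_bigr => j _ /=.
rewrite comp_lfunE sproj_id ?eY0 ?eA // [in RHS](coord_basis be (eA _ (e_even j))).
by rewrite !linear_sum; apply: eq_bigr => i _; rewrite !linearZ mulrC.
Qed.

Lemma qtr_sbr X Y : X \in qalg J -> Y \in qalg J -> qtr J (sbr X Y) = 0.
Proof.
move=> XQ YQ.
have h a b : qtr J (sbr (hcomp a X) (hcomp b Y)) = 0.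
  have [pX pY] := (hcomp_parity a X, hcomp_parity b Y).
  have [aQ bQ] := (qalg_hcomp a XQ, qalg_hcomp b YQ).
  case: a b pX pY aQ bQ => [] [] pX pY aQ bQ.
  - exact/qtr_even/(parity_is_sbr pX pY).
  - by rewrite (sbr_evenr _ pY) -scaleN1r qtrD qtrZ qtr_mulC // mulN1r subrr.
  - by rewrite (sbr_evenl _ pX) -scaleN1r qtrD qtrZ (qtr_mulC pY pX aQ) mulN1r subrr.
  - exact/qtr_even/(parity_is_sbr pX pY).
have hY a : qtr J (sbr (hcomp a X) Y) = 0.
  by rewrite -[Y]hcomp_sum sbrDr qtrD (h a false) (h a true) addr0.
by rewrite -[X]hcomp_sum sbrDl qtrD (hY false) (hY true) addr0.
Qed.

(** So the queer trace is not identically zero on [qalg J] when [V] is non-zero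
    and the characteristic is zero. *)
Lemma qtr_xi : qtr J qxi = - (\dim (spart V false))%:R.
Proof.
rewrite qtr_trace (eq_bigr (fun _ => 1)) ?sumr_const ?card_ord // => i _.
rewrite (qxiE (a := true) (parity_isP _ _ oJ _ _ (e_even i))) queerJK expr1.
by rewrite scaleN1r opprK sproj_id // coord_free ?(basis_free be) // eqxx.
Qed.

End Queer.

(** * Operators on a tensor product *)

Section Tensor.
Variables (K : fieldType) (V1 V2 : superspace K).
Let V := stensor V1 V2.
Implicit Types (P Q : 'End(V1)) (Y Z : 'End(V2)) (a b c : bool).

Lemma otimesDl P Q Y : otimes (P + Q) Y = otimes P Y + otimes Q Y.
Proof. exact: (linearD (otimesl Y)). Qed.

Lemma otimesZl k P Y : otimes (k *: P) Y = k *: otimes P Y.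
Proof. exact: (linearZZ (otimesl Y)). Qed.

Lemma otimesDr P Y Z : otimes P (Y + Z) = otimes P Y + otimes P Z.
Proof. exact: (linearD (otimes P)). Qed.

Lemma otimesZr k P Y : otimes P (k *: Y) = k *: otimes P Y.
Proof. exact: (linearZZ (otimes P)). Qed.

Lemma otimesBl P Q Y : otimes (P - Q) Y = otimes P Y - otimes Q Y.
Proof. exact: (linearB (otimesl Y)). Qed.

Lemma otimesBr P Y Z : otimes P (Y - Z) = otimes P Y - otimes P Z.
Proof. exact: (linearB (otimes P)). Qed.

Lemma otimes0l Y : otimes 0 Y = 0 :> 'End(V).
Proof. by rewrite -[0 in LHS](scale0r 0) otimesZl scale0r. Qed.

Lemma otimes0r P : otimes P 0 = 0 :> 'End(V).
Proof. exact: (linear0 (otimes P)). Qed.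

Lemma otimes_sumr P I (r : seq I) (B : pred I) (G : I -> 'End(V2)) :
  otimes P (\sum_(i <- r | B i) G i) = \sum_(i <- r | B i) otimes P (G i).
Proof. by apply: (big_morph (otimes P)); [exact: otimesDr | exact: otimes0r]. Qed.

Lemma tens_homogeneous_ext (W : vectType K) (f g : 'Hom(tspace V1 V2, W)) :
  (forall a v w, v \in spart V1 a -> f (tens v w) = g (tens v w)) -> f = g.
Proof.
move=> fg; apply: tens_ext => v w.
have := tens_linearl w 1 (sproj V1 false v) (sproj V1 true v).
rewrite !scale1r sproj_sum => ->; rewrite !linearD /=.
by rewrite (fg _ _ _ (sproj_mem false v)) (fg _ _ _ (sproj_mem true v)).
Qed.

Lemma otimes1 : otimes \1%VF \1%VF = \1%VF :> 'End(V).
Proof.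
apply: tens_homogeneous_ext => a v w va.
by rewrite (otimesE _ _ va (parity_is1 V2)) andbF scale1r !id_lfunE.
Qed.

Lemma otimes_parity a b P Y :
  parity_is a P -> parity_is b Y -> parity_is (a (+) b) (otimes P Y : 'End(V)).
Proof.
move=> /parity_isP pP pY; apply/parity_isP => c v vc; rewrite memv_preim.
move: v vc; apply/subvP/tpart_ind => c' v w vc wc.
rewrite -memv_preim (otimesE _ _ vc pY) memvZ //.
have := tens_tpart (pP _ _ vc) (parity_isP _ _ pY _ _ wc).
by rewrite (_ : a (+) c' (+) _ = a (+) b (+) c) //; case: (a) (b) (c) (c') => [] [] [] [].
Qed.

(** Moving [Y] past [Q] costs the Koszul sign, whatever [P] and [Z] are. All the
    bracket formulas below follow from this one. *)
Lemma otimes_comp a b P Q Y Z : parity_is a Q -> parity_is b Y ->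
  (otimes P Y \o otimes Q Z)%VF =
  (-1) ^+ (a && b) *: otimes (P \o Q)%VF (Y \o Z)%VF :> 'End(V).
Proof.
move=> pQ pY; have h c : (otimes P Y \o otimes Q (hcomp c Z))%VF =
    (-1) ^+ (a && b) *: otimes (P \o Q)%VF (Y \o hcomp c Z)%VF :> 'End(V).
  have pZ := hcomp_parity c Z; apply: tens_homogeneous_ext => a' v w va.
  rewrite comp_lfunE scale_lfunE (otimesE _ _ va pZ) linearZ /=.
  rewrite (otimesE _ _ (parity_isP _ _ pQ _ _ va) pY).
  rewrite (otimesE _ _ va (parity_is_comp pY pZ)) !scalerA !comp_lfunE -!signr_addb.
  by congr (_ *: _); case: a a' b c {pQ pY pZ va} => [] [] [] [].
by rewrite -[Z]hcomp_sum comp_lfunDr !otimesDr comp_lfunDr (h false) (h true) scalerDr.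
Qed.

Lemma hcomp_otimes a b P Y : parity_is b Y ->
  hcomp a (otimes P Y : 'End(V)) = otimes (hcomp (a (+) b) P) Y.
Proof.
move=> pY; rewrite -{1}[P]hcomp_sum otimesDl linearD /=.
have h c := otimes_parity (hcomp_parity c P) pY.
case: a b pY h => [] [] pY h /=.
- by rewrite (hcomp_id (h false)) (parity_is_hcomp (h true)) ?addr0.
- by rewrite (hcomp_id (h true)) (parity_is_hcomp (h false)) ?add0r.
- by rewrite (hcomp_id (h true)) (parity_is_hcomp (h false)) ?add0r.
- by rewrite (hcomp_id (h false)) (parity_is_hcomp (h true)) ?addr0.
Qed.

Lemma sbr_otimesl P Q Y :
  sbr (otimes P \1%VF) (otimes Q Y) = otimes (sbr P Q) Y :> 'End(V).
Proof.
have h a b c : sbr (otimes (hcomp a P) \1%VF) (otimes (hcomp b Q) (hcomp c Y)) =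
    otimes (sbr (hcomp a P) (hcomp b Q)) (hcomp c Y) :> 'End(V).
  move: (hcomp_parity a P) (hcomp_parity b Q) (hcomp_parity c Y) => pP pQ pY.
  have p1 := parity_is1 V2.
  rewrite (sbrE (otimes_parity pP p1) (otimes_parity pQ pY)).
  rewrite (otimes_comp _ _ pQ p1) (otimes_comp _ _ pP pY) (sbrE pP pQ).
  rewrite otimesBl otimesZl comp_lfun1l comp_lfun1r andbF scale1r scalerA -signr_addb.
  rewrite (_ : (a (+) false) && (b (+) c) (+) (a && c) = a && b) //.
  by case: (a) (b) (c) => [] [] [].
have hY a b : sbr (otimes (hcomp a P) \1%VF) (otimes (hcomp b Q) Y) =
    otimes (sbr (hcomp a P) (hcomp b Q)) Y :> 'End(V).
  by rewrite -[Y]hcomp_sum !otimesDr sbrDr (h a b false) (h a b true).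
have hQ a : sbr (otimes (hcomp a P) \1%VF) (otimes Q Y) =
    otimes (sbr (hcomp a P) Q) Y :> 'End(V).
  by rewrite -[Q]hcomp_sum otimesDl !sbrDr otimesDl (hY a false) (hY a true).
by rewrite -[P]hcomp_sum otimesDl !sbrDl otimesDl (hQ false) (hQ true).
Qed.

Lemma sbr_otimesr P Y Z :
  sbr (otimes P Y) (otimes \1%VF Z) = otimes P (sbr Y Z) :> 'End(V).
Proof.
have h a b c : sbr (otimes (hcomp a P) (hcomp b Y)) (otimes \1%VF (hcomp c Z)) =
    otimes (hcomp a P) (sbr (hcomp b Y) (hcomp c Z)) :> 'End(V).
  move: (hcomp_parity a P) (hcomp_parity b Y) (hcomp_parity c Z) => pP pY pZ.
  have p1 := parity_is1 V1.
  rewrite (sbrE (otimes_parity pP pY) (otimes_parity p1 pZ)).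
  rewrite (otimes_comp _ _ p1 pY) (otimes_comp _ _ pP pZ) (sbrE pY pZ).
  rewrite otimesBr otimesZr comp_lfun1l comp_lfun1r scale1r scalerA -signr_addb.
  rewrite (_ : (a (+) b) && (false (+) c) (+) (a && c) = b && c) //.
  by case: (a) (b) (c) => [] [] [].
have hP b c : sbr (otimes P (hcomp b Y)) (otimes \1%VF (hcomp c Z)) =
    otimes P (sbr (hcomp b Y) (hcomp c Z)) :> 'End(V).
  by rewrite -[P]hcomp_sum !otimesDl sbrDl (h false b c) (h true b c).
have hY c : sbr (otimes P Y) (otimes \1%VF (hcomp c Z)) =
    otimes P (sbr Y (hcomp c Z)) :> 'End(V).
  by rewrite -[Y]hcomp_sum otimesDr !sbrDl otimesDr (hP false c) (hP true c).
by rewrite -[Z]hcomp_sum otimesDr !sbrDr otimesDr (hY false) (hY true).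
Qed.

(** With even second factors no Koszul sign appears, and the bracket mixes
    commutators and anticommutators of both factors. *)
Lemma sbr_otimes_even a b P Q Y Z : parity_is a P -> parity_is b Q ->
  parity_is false Y -> parity_is false Z ->
  sbr (otimes P Y) (otimes Q Z) =
    otimes (P \o Q)%VF (Y \o Z)%VF
      - (-1) ^+ (a && b) *: otimes (Q \o P)%VF (Z \o Y)%VF :> 'End(V).
Proof.
move=> pP pQ pY pZ; rewrite (sbrE (otimes_parity pP pY) (otimes_parity pQ pZ)).
by rewrite (otimes_comp _ _ pQ pY) (otimes_comp _ _ pP pZ) !andbF !scale1r !addbF.
Qed.

Lemma sbr_otimesJ (J : 'End(V1)) b P Y : parity_is true J -> parity_is b Y ->
  sbr (otimes P Y) (otimes J \1%VF) = (-1) ^+ b *: otimes (sbr P J) Y :> 'End(V).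
Proof.
move=> oJ pY; have p1 := parity_is1 V2.
have h a : sbr (otimes (hcomp a P) Y) (otimes J \1%VF) =
    (-1) ^+ b *: otimes (sbr (hcomp a P) J) Y :> 'End(V).
  have pP := hcomp_parity a P.
  rewrite (sbrE (otimes_parity pP pY) (otimes_parity oJ p1)).
  rewrite (otimes_comp _ _ oJ pY) (otimes_comp _ _ pP p1) (sbrE pP oJ).
  rewrite otimesBl otimesZl comp_lfun1l comp_lfun1r !andbT andbF scale1r.
  by rewrite scalerBr scalerA -signr_addb addbC.
by rewrite -[P]hcomp_sum otimesDl !sbrDl otimesDl (h false) (h true) scalerDr.
Qed.

Section QueerFactor.
Variable J1 : 'End(V1).
Hypotheses (oJ : parity_is true J1) (JJ : (J1 \o J1)%VF = - \1%VF).
Let J : 'End(V) := otimes J1 \1%VF.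

Lemma otimesJ_odd : parity_is true J.
Proof. exact: otimes_parity oJ (parity_is1 V2). Qed.

Lemma otimesJ_sq : (J \o J)%VF = - \1%VF.
Proof.
rewrite /J (otimes_comp _ _ oJ (parity_is1 V2)) andbF scale1r JJ comp_lfun1l.
by rewrite -[- _]scaleN1r otimesZl otimes1 scaleN1r.
Qed.

Lemma otimes_qalg P Y : P \in qalg J1 -> otimes P Y \in qalg J.
Proof.
rewrite mem_qalg => /eqP P0; rewrite -[Y]hcomp_sum otimesDr memvD //.
  by rewrite mem_qalg /J (sbr_otimesJ _ oJ (hcomp_parity _ _)) P0 otimes0l scaler0.
by rewrite mem_qalg /J (sbr_otimesJ _ oJ (hcomp_parity _ _)) P0 otimes0l scaler0.
Qed.

End QueerFactor.

Section HomogeneousBasis.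
Variables (d : nat) (w : d.-tuple V2) (p : 'I_d -> bool).
Hypotheses (bw : basis_of fullv w) (hw : forall k : 'I_d, w`_k \in spart V2 (p k)).
Local Notation F := (munit w).

(** Applying the projection on parity [a] to the expansion of [v] discards the
    terms of the other parity without changing [v]. *)
Lemma coord_parity a v (k : 'I_d) : v \in spart V2 a -> p k != a -> coord w k v = 0.
Proof.
move=> va ka; have fw := basis_free bw.
have vE : v = \sum_i (if p i == a then coord w i v else 0) *: w`_i.
  rewrite -[LHS](sproj_id va) [in LHS](coord_basis bw (memvf v)) linear_sum.
  apply: eq_bigr => i _; rewrite linearZ /=; have := hw i.
  have [-> wa | ia] := eqVneq; first by rewrite sproj_id.
  have -> : p i = ~~ a by case: (p i) (a) ia => [] [].
  by move=> wa; rewrite sproj_0 // scaler0 scale0r.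
by rewrite {1}vE coord_sum_free // (negPf ka).
Qed.

Lemma munit_parity k l : parity_is (p k (+) p l) (F k l).
Proof.
apply/parity_isP => a v va; rewrite munitE.
have [<- | la] := eqVneq (p l) a; first by rewrite -addbA addbb addbF memvZ.
by rewrite (coord_parity va la) scale0r mem0v.
Qed.

Definition contract (k : 'I_d) : 'Hom(tspace V1 V2, V1) :=
  tlift (fun v u => coord w k u *: v).

Lemma contractE k v u : contract k (tens v u) = coord w k u *: v.
Proof.
rewrite tliftE // => [u' c x y | v' c x y].
  by rewrite scalerDr !scalerA mulrC.
by rewrite linearP scalerDl scalerA.
Qed.

HB.instance Definition _ (v : V1) :=
  GRing.isLinear.Build K V2 (tspace V1 V2) _ (tens v) (tens_linearr v).

Definition tensr (u : V2) (v : V1) : tspace V1 V2 := tens v u.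
HB.instance Definition _ (u : V2) :=
  GRing.isLinear.Build K V1 (tspace V1 V2) _ (tensr u) (tens_linearl u).

Lemma lin_tensrE u v : linfun (tensr u) v = tens v u.
Proof. by rewrite lfunE. Qed.

Lemma otimes_munitE a P (k l : 'I_d) v : v \in spart V1 a ->
  otimes P (F k l) (tens v w`_l) = (-1) ^+ (a && (p k (+) p l)) *: tens (P v) w`_k.
Proof.
move=> va; rewrite (otimesE _ _ va (munit_parity k l)) munitE.
by rewrite coord_free ?(basis_free bw) // eqxx scale1r.
Qed.

Lemma otimes_munit_eq0 P k l : otimes P (F k l) = 0 :> 'End(V) -> P = 0.
Proof.
move=> P0; apply: homogeneous_ext => a v va; rewrite zero_lfunE.
have := otimes_munitE P k l va; rewrite P0 zero_lfunE => /(congr1 (contract k)).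
rewrite linear0 linearZ /= contractE coord_free ?(basis_free bw) // eqxx scale1r.
by move=> /esym/eqP; rewrite scaler_eq0 signr_eq0 => /eqP.
Qed.

(** The units [F_kk] are even, so compressing by them acts on the second factor
    alone and without sign. *)
Lemma corner_otimes (k l : 'I_d) P Y :
  (otimes \1%VF (F k k) \o otimes P Y \o otimes \1%VF (F l l))%VF =
  coord w k (Y w`_l) *: otimes P (F k l) :> 'End(V).
Proof.
have e i : parity_is false (F i i) by have := munit_parity i i; rewrite addbb.
rewrite -[P]hcomp_sum !otimesDl scalerDr comp_lfunDr comp_lfunDl.
suff h a : (otimes \1%VF (F k k) \o otimes (hcomp a P) Y \o otimes \1%VF (F l l))%VF =
  coord w k (Y w`_l) *: otimes (hcomp a P) (F k l) :> 'End(V) by rewrite !h.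
rewrite (otimes_comp _ _ (hcomp_parity a P) (e k)) andbF scale1r.
rewrite -[Y]hcomp_sum comp_lfunDr otimesDr comp_lfunDl.
have h b : (otimes (\1 \o hcomp a P)%VF (F k k \o hcomp b Y)%VF \o otimes \1%VF (F l l))%VF =
  coord w k (hcomp b Y w`_l) *: otimes (hcomp a P) (F k l) :> 'End(V).
  rewrite (otimes_comp _ _ (parity_is1 V1) (parity_is_comp (e k) (hcomp_parity b Y))).
  rewrite scale1r comp_lfun1l comp_lfun1r -otimesZr; congr otimes.
  apply/lfunP => v; rewrite scale_lfunE !comp_lfunE !munitE !linearZ /= !scalerA.
  by rewrite mulrC.
by rewrite !h -scalerDl add_lfunE linearD.
Qed.

(** The coefficient [P k l] sends [v] to the [k]-th contraction of
    [X (v (x) w_l)]. The grading operator enters when [F_kl] is odd, to cancel the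
    sign with which [F_kl] passes [v]. *)
Lemma otimes_decomp (X : 'End(V)) : exists P : 'I_d -> 'I_d -> 'End(V1),
  X = \sum_k \sum_l otimes (P k l) (F k l).
Proof.
pose s k l : 'End(V1) := if p k (+) p l then sgrade V1 else \1%VF.
pose P (k l : 'I_d) : 'End(V1) :=
  (contract k \o (X \o linfun (tensr w`_l)) \o s k l)%VF.
exists P; apply: tens_homogeneous_ext => a v u va.
have termE k l : otimes (P k l) (F k l) (tens v u) =
    tens (contract k (X (tens v (coord w l u *: w`_l)))) w`_k.
  rewrite (otimesE _ _ va (munit_parity k l)) munitE.
  have -> : P k l v = (-1) ^+ (a && (p k (+) p l)) *: contract k (X (tens v w`_l)).
    rewrite !comp_lfunE /s; case: (p k (+) p l); last first.
      by rewrite id_lfunE andbF scale1r lin_tensrE.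
    by rewrite (sgradeE va) andbT !linearZ /= lin_tensrE.
  rewrite -![tens (_ *: _) _]/(tensr _ _) linearZ /= scalerA -expr2 sqrr_sign scale1r.
  by rewrite /tensr !linearZ -[tens (_ *: _) _]/(tensr _ _) linearZ.
have contr_sum M : M = \sum_(k < d) tens (contract k M) w`_k.
  transitivity ((\sum_(k < d) (linfun (tensr w`_k) \o contract k)%VF) M); last first.
    by rewrite sum_lfunE; apply: eq_bigr => k _; rewrite comp_lfunE lin_tensrE.
  rewrite -[LHS]id_lfunE; congr (fun_of_lfun _ M); apply: tens_ext => v' u'.
  rewrite id_lfunE sum_lfunE [in LHS](coord_basis bw (memvf u')) linear_sum.
  by apply: eq_bigr => k _; rewrite comp_lfunE lin_tensrE contractE linearZ -[RHS]/(tensr _ _) linearZ.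
rewrite sum_lfunE [LHS]contr_sum; apply: eq_bigr => k _; rewrite sum_lfunE.
rewrite (eq_bigr _ (fun l _ => termE k l)) -[LHS]/(tensr _ _).
rewrite {1}(coord_basis bw (memvf u)) !linear_sum.
by apply: eq_bigr.
Qed.

Lemma corner_sum (P : 'I_d -> 'I_d -> 'End(V1)) k l :
  (otimes \1%VF (F k k) \o (\sum_i \sum_j otimes (P i j) (F i j))
     \o otimes \1%VF (F l l))%VF = otimes (P k l) (F k l) :> 'End(V).
Proof.
have termE i j : (otimes \1%VF (F k k) \o otimes (P i j) (F i j)
    \o otimes \1%VF (F l l))%VF =
    ((i == k) && (j == l))%:R *: otimes (P i j) (F k l) :> 'End(V).
  rewrite corner_otimes munitE linearZ /= !coord_free ?(basis_free bw) //.
  by rewrite -natrM mulnb andbC (eq_sym l).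
rewrite -(sum_delta2 (fun i j => otimes (P i j) (F k l)) k l).
rewrite comp_lfun_sumr comp_lfun_suml; apply: eq_bigr => i _.
by rewrite comp_lfun_sumr comp_lfun_suml; apply: eq_bigr.
Qed.

(** Each [P_kl (x) F_kl] is a corner of [X], hence in the queer algebra, and its
    bracket with [J1 (x) 1] is [[P_kl, J1] (x) F_kl] up to sign. *)
Lemma otimes_decomp_qalg (J1 : 'End(V1)) (X : 'End(V)) :
  parity_is true J1 ->
  X \in qalg (otimes J1 \1%VF : 'End(V)) ->
  exists P : 'I_d -> 'I_d -> 'End(V1),
    (forall k l, P k l \in qalg J1) /\
    X = \sum_k \sum_l otimes (P k l) (F k l).
Proof.
move=> oJ XQ; have [P XE] := otimes_decomp X; exists P; split=> // k l.
have oJ' := otimesJ_odd oJ.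
have FQ i : otimes \1%VF (F i i) \in qalg (otimes J1 \1%VF : 'End(V)).
  exact/otimes_qalg/qalg1.
have := qalgM oJ' (qalgM oJ' (FQ k) XQ) (FQ l).
rewrite XE corner_sum mem_qalg (sbr_otimesJ _ oJ (munit_parity k l)).
rewrite scaler_eq0 signr_eq0 /= => /eqP/otimes_munit_eq0 PJ.
by rewrite mem_qalg PJ.
Qed.

Lemma sbr_munit i j k l : sbr (F i j) (F k l) =
  (j == k)%:R *: F i l
    - (-1) ^+ ((p i (+) p j) && (p k (+) p l)) *: ((l == i)%:R *: F k j).
Proof.
by rewrite (sbrE (munit_parity i j) (munit_parity k l)) !munit_mul ?(basis_free bw).
Qed.

(** Brackets with matrix units move either index of [F_kl], as long as the two
    stay distinct. This reaches every [F_ij] except possibly the transpose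
    [F_lk]. If [k] and [l] have the same parity, then [F_lk] comes from
    [[[F_kl, F_lk], F_lk] = - 2 F_lk]; for opposite parities that bracket is zero,
    as in [gl(1|1)], but then [p0] or [q0] is a third index to pass through. *)
Lemma munit_offdiag (U : {vspace 'End(V2)}) (p0 q0 k l i j : 'I_d) :
  2%:R != 0 :> K -> p0 != q0 -> p p0 = p q0 ->
  (forall Y Z, Y \in U -> sbr Y Z \in U) ->
  k != l -> F k l \in U -> i != j -> F i j \in U.
Proof.
move=> n2 pq ppq Uad kl Ukl ij.
have A (x y z : 'I_d) : x != z -> F x y \in U -> F x z \in U.
  move=> xz /(Uad _ (F y z)); rewrite sbr_munit eqxx scale1r.
  by rewrite (eq_sym z) (negPf xz) scale0r scaler0 subr0.
have B (x y z : 'I_d) : y != z -> F x y \in U -> F z y \in U.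
  move=> yz /(Uad _ (F z x)); rewrite sbr_munit eqxx scale1r (negPf yz) scale0r.
  rewrite sub0r memvN => /(memvZ ((-1) ^+ ((p x (+) p y) && (p z (+) p x)))).
  by rewrite scalerA -expr2 sqrr_sign scale1r.
have [jk | jk] := eqVneq j k; last first.
  by apply: (B k); rewrite 1?eq_sym //; apply: (A _ l); rewrite // eq_sym.
have [il | il] := eqVneq i l; last first.
  by apply: (A _ l) => //; apply: (B k); rewrite // eq_sym.
rewrite jk il in ij *.
have third r : r != k -> r != l -> F l k \in U.
  move=> rk rl; apply: (A l r) => //; apply: (B k r) => //.
  by apply: (A k l); rewrite // eq_sym.
have [pkl | pkl] := eqVneq (p k) (p l).
  have := Uad _ (F l k) (Uad _ (F l k) Ukl).
  rewrite sbr_munit !eqxx !scale1r pkl addbb expr0 scale1r.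
  rewrite sbrDl -[- F l l]scaleN1r sbrZl !sbr_munit.
  rewrite !eqxx (negPf kl) pkl !addbb !expr0 !scale0r !scale1r sub0r subr0.
  rewrite scaleN1r -opprD memvN -mulr2n -scaler_nat => /(memvZ 2%:R^-1).
  by rewrite scalerA mulVf // scale1r.
have [p0k | p0k] := eqVneq p0 k.
  apply: (third q0); first by rewrite -p0k eq_sym.
  by apply: contraNneq pkl => <-; rewrite -p0k ppq.
have [p0l | p0l] := eqVneq p0 l; last exact: (third p0).
apply: (third q0); last by rewrite -p0l eq_sym.
by apply: contraNneq pkl => <-; rewrite -p0l ppq.
Qed.

End HomogeneousBasis.
End Tensor.

(** The supertrace of the identity is recorded as the sum of signs, and a part of
    dimension at least two gives two basis vectors of the same parity. *)
Lemma homogeneous_basis (K : fieldType) (V : superspace K) :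
  exists d (w : d.-tuple V) (p : 'I_d -> bool),
  [/\ basis_of fullv w, forall k : 'I_d, w`_k \in spart V (p k),
      \sum_k (-1) ^+ p k =
        (\dim (spart V false))%:R - (\dim (spart V true))%:R :> K
    & forall a, (1 < \dim (spart V a))%N ->
        exists i j, i != j /\ p i = p j].
Proof.
set m := \dim (spart V false); set n := \dim (spart V true).
pose w : (m + n).-tuple V :=
  cat_tuple (vbasis (spart V false)) (vbasis (spart V true)).
pose p (k : 'I_(m + n)) : bool := if split k is inr _ then true else false.
have pl i : p (lshift n i) = false by rewrite /p (unsplitK (inl i)).
have pr i : p (rshift m i) = true by rewrite /p (unsplitK (inr i)).
exists (m + n)%N, w, p; split.
- rewrite -(spart_add V); apply: cat_basis; rewrite ?vbasisP //.
  by apply/directv_addP; exact: spart_cap.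
- move=> k; rewrite /p -{1}[k]splitK; case: (split k) => i /=.
    by rewrite nth_cat size_tuple ltn_ord vbasis_mem // mem_nth // size_tuple.
  rewrite nth_cat size_tuple ltnNge leq_addr /= addKn.
  by rewrite vbasis_mem // mem_nth // size_tuple.
- rewrite big_split_ord /= (eq_bigr (fun _ => 1)) => [|i _]; last by rewrite pl.
  rewrite [X in _ + X](eq_bigr (fun _ => -1)) => [|i _]; last by rewrite pr.
  by rewrite sumrN !sumr_const !card_ord.
- case=> d1.
    exists (rshift m (Ordinal (ltnW d1))), (rshift m (Ordinal d1)).
    by rewrite !pr (inj_eq (@rshift_inj _ _)).
  exists (lshift n (Ordinal (ltnW d1))), (lshift n (Ordinal d1)).
  by rewrite !pl (inj_eq (@lshift_inj _ _)).
Qed.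

(** * Subsuperalgebras between [odot] and the queer superalgebra *)

Section Maximality.
Variables (K : fieldType) (V1 V2 : superspace K) (J1 : 'End(V1)).
Hypothesis n2 : 2%:R != 0 :> K.
Hypotheses (oJ : parity_is true J1) (JJ : (J1 \o J1)%VF = - \1%VF).
Variables (d : nat) (w : d.-tuple V2) (p : 'I_d -> bool).
Hypotheses (bw : basis_of fullv w) (hw : forall k : 'I_d, w`_k \in spart V2 (p k)).
Let V := stensor V1 V2.
Let J : 'End(V) := otimes J1 \1%VF.
Let oJV : parity_is true J := otimesJ_odd V2 oJ.
Let JJV : (J \o J)%VF = - \1%VF := otimesJ_sq V2 oJ JJ.
Let g : {vspace 'End(V)} := odot (qalg J1) (fullv : {vspace 'End(V2)}).
Local Notation F := (munit w).
Implicit Types (P Q : 'End(V1)) (Y Z : 'End(V2)) (X : 'End(V)).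

Let F_even i : parity_is false (F i i).
Proof. by have := munit_parity bw hw i i; rewrite addbb. Qed.

Lemma odot_l P : P \in qalg J1 -> otimes P \1%VF \in g.
Proof.
move=> PQ; apply/mem_odot; exists P, 0; split; rewrite ?mem0v //.
by rewrite otimes0r addr0.
Qed.

Lemma odot_r Y : otimes \1%VF Y \in g.
Proof.
apply/mem_odot; exists 0, Y; split; rewrite ?mem0v ?memvf //.
by rewrite otimes0l add0r.
Qed.

Lemma sbr_1l Y : sbr \1%VF Y = 0 :> 'End(V2).
Proof. by rewrite sbr_evenl ?parity_is1 // comp_lfun1l comp_lfun1r subrr. Qed.

Lemma sbr_otimes_factors P Y : sbr (otimes \1%VF Y) (otimes P \1%VF) = 0 :> 'End(V).
Proof.
have h a b : sbr (otimes \1%VF (hcomp b Y)) (otimes (hcomp a P) \1%VF) = 0 :> 'End(V).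
  have [pP pY] := (hcomp_parity a P, hcomp_parity b Y).
  rewrite (sbrE (otimes_parity (parity_is1 V1) pY) (otimes_parity pP (parity_is1 V2))).
  rewrite (otimes_comp _ _ pP pY) (otimes_comp _ _ (parity_is1 V1) (parity_is1 V2)).
  by rewrite !comp_lfun1l !comp_lfun1r scale1r addbF andbC subrr.
have hP b : sbr (otimes \1%VF (hcomp b Y)) (otimes P \1%VF) = 0 :> 'End(V).
  by rewrite -[P]hcomp_sum otimesDl sbrDr (h false b) (h true b) addr0.
by rewrite -[Y]hcomp_sum otimesDr sbrDl (hP false) (hP true) addr0.
Qed.

Lemma odot_lie : is_lie_subsuperalgebra g.
Proof.
split=> [a _ /mem_odot[P [Y [PQ _ ->]]]|].
  rewrite linearD memvD //=.
    by rewrite (hcomp_otimes _ _ (parity_is1 V2)) odot_l ?(qalg_hcomp oJ).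
  have h b : hcomp a (otimes \1%VF (hcomp b Y) : 'End(V)) \in g.
    rewrite (hcomp_otimes _ _ (hcomp_parity b Y)).
    have [<- | ab] := eqVneq a b; first by rewrite addbb hcomp_id ?parity_is1 ?odot_r.
    rewrite (parity_is_hcomp (parity_is1 V1)) ?otimes0l ?mem0v //.
    by case: (a) (b) ab => [] [].
  by rewrite -[Y]hcomp_sum otimesDr linearD memvD //= h.
move=> _ _ /mem_odot[P [Y [PQ _ ->]]] /mem_odot[Q [Z [QQ _ ->]]].
rewrite sbrDl !sbrDr sbr_otimesl sbr_otimes_factors sbr_otimesr sbr_otimesr sbr_1l.
rewrite otimes0r addr0 add0r.
by rewrite memvD ?odot_l ?odot_r ?(qalg_sbr oJ).
Qed.

Lemma odot_sub_qalg : (g <= qalg J)%VS.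
Proof.
apply/subvP => _ /mem_odot[P [Y [PQ _ ->]]].
by rewrite memvD ?(otimes_qalg oJ) ?(qalg1 oJ).
Qed.

Let sbr_munitC k l : sbr (F k l) (F l k) = F k k - (-1) ^+ (p k (+) p l) *: F l l.
Proof. by rewrite (sbr_munit bw hw) !eqxx !scale1r (addbC (p l)) andbb. Qed.

Lemma qtr_offdiag P k l : P \in qalg J1 -> k != l -> qtr J (otimes P (F k l)) = 0.
Proof.
move=> PQ kl; have -> : F k l = sbr (F k k) (F k l).
  by rewrite (sbr_munit bw hw) eqxx eq_sym (negPf kl) scale0r scaler0 subr0 scale1r.
by rewrite -sbr_otimesr (qtr_sbr oJV JJV) ?(otimes_qalg oJ) ?(qalg1 oJ).
Qed.

Lemma qtr_diag P k l : P \in qalg J1 ->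
  qtr J (otimes P (F k k)) = (-1) ^+ (p k (+) p l) * qtr J (otimes P (F l l)).
Proof.
move=> PQ; have := qtr_sbr oJV JJV (otimes_qalg oJ (F k l) PQ)
  (otimes_qalg oJ (F l k) (qalg1 oJ)).
rewrite sbr_otimesr sbr_munitC otimesBr otimesZr -scaleN1r qtrD !qtrZ mulN1r.
by move/eqP; rewrite subr_eq0 => /eqP.
Qed.

(** Modulo brackets [P (x) F_kk] is [P (x) F_ll] up to the sign of the relative
    parity, so the queer trace of [P (x) 1] is a multiple of the supertrace of
    the identity of [V2]. The operators [1 (x) F_kl] are brackets off the diagonal
    and even on it. *)
Lemma odot_sub_sqalg : \sum_k (-1) ^+ p k = 0 :> K -> (g <= sqalg J)%VS.
Proof.
move=> str0; apply/subvP => X Xg; rewrite mem_sqalg -mem_qalg.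
rewrite (subvP odot_sub_qalg) //=.
case/mem_odot: Xg => P [Y [PQ _ ->]]; rewrite qtrD.
rewrite -{1}(munit_sum1 bw) {1}(munit_decomp bw Y) !otimes_sumr !qtr_sum.
rewrite [X in _ + X]big1 ?addr0 => [|k _]; last first.
  rewrite otimes_sumr qtr_sum big1 // => l _; rewrite otimesZr qtrZ.
  have [<- | kl] := eqVneq k l; last by rewrite (qtr_offdiag (qalg1 oJ) kl) mulr0.
  by rewrite (qtr_even oJV JJV) ?mulr0 // (otimes_parity (parity_is1 V1) (F_even k)).
case: (pickP 'I_d) => [k0 _ | d0]; last by rewrite big1 // => k; have := d0 k.
rewrite (eq_bigr (fun k => (-1) ^+ p k * ((-1) ^+ p k0 * qtr J (otimes P (F k0 k0))))).
  by rewrite -mulr_suml str0 mul0r.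
by move=> k _; rewrite (qtr_diag k k0 PQ) signr_addb mulrA.
Qed.

Lemma odot_offdiag P k l : P \notin <[\1%VF]>%VS -> k != l ->
  otimes P (F k l) \notin g.
Proof.
move=> nP kl; apply: contra nP => /mem_odot[Q [Y [_ _ E]]].
have := congr1 (fun X : 'End(V) => otimes \1%VF (F k k) \o X \o otimes \1%VF (F l l))%VF E.
rewrite comp_lfunDr comp_lfunDl !(corner_otimes bw hw).
rewrite id_lfunE coord_free ?(basis_free bw) // eq_sym (negPf kl) scale0r add0r.
rewrite munitE linearZ /= !coord_free ?(basis_free bw) // !eqxx mulr1 scale1r.
rewrite -otimesZl => /eqP; rewrite -subr_eq0 -otimesBl.
move=> /eqP/(otimes_munit_eq0 bw hw)/eqP; rewrite subr_eq0 => /eqP ->.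
by rewrite memvZ ?memv_line.
Qed.

Section Overalgebra.
Variables (h : {vspace 'End(V)}) (p0 q0 : 'I_d).
Hypotheses (hlie : is_lie_subsuperalgebra h) (gh : (g <= h)%VS).
Hypotheses (hq : (h <= qalg J)%VS) (pq : p0 != q0) (ppq : p p0 = p q0).

Lemma over_adl P X : P \in qalg J1 -> X \in h -> sbr (otimes P \1%VF) X \in h.
Proof. by move=> PQ Xh; apply: hlie.2 => //; apply: (subvP gh); apply: odot_l. Qed.

Lemma over_adr X Y : X \in h -> sbr X (otimes \1%VF Y) \in h.
Proof. by move=> Xh; apply: hlie.2 => //; apply: (subvP gh); apply: odot_r. Qed.

Lemma over_ad_left P Q Y : P \in qalg J1 -> otimes Q Y \in h ->
  otimes (sbr P Q) Y \in h.
Proof. by move=> PQ /(over_adl PQ); rewrite sbr_otimesl. Qed.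

Lemma over_ad_right P Y Z : otimes P Y \in h -> otimes P (sbr Y Z) \in h.
Proof. by move=> /(over_adr Z); rewrite sbr_otimesr. Qed.

Lemma over_offdiag P k l i j :
  k != l -> otimes P (F k l) \in h -> i != j -> otimes P (F i j) \in h.
Proof.
move=> kl Pkl ij.
have memU Y : (Y \in (linfun (otimes P) @^-1: h)%VS) = (otimes P Y \in h).
  by rewrite -memv_preim lfunE.
rewrite -memU; apply: (munit_offdiag bw hw n2 pq ppq _ kl _ ij); last by rewrite memU.
by move=> Y Z; rewrite !memU; apply: over_ad_right.
Qed.

Lemma over_corner X k l : k != l -> X \in h ->
  (otimes \1%VF (F k k) \o X \o otimes \1%VF (F l l))%VF \in h.
Proof.
have eM i j : (otimes \1%VF (F i i) \o otimes \1%VF (F j j))%VF =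
    (i == j)%:R *: otimes \1%VF (F i j) :> 'End(V).
  rewrite (otimes_comp _ _ (parity_is1 V1) (F_even i)) scale1r comp_lfun1l.
  by rewrite munit_mul ?(basis_free bw) // otimesZr.
have ad i (Z : 'End(V)) : Z \in h ->
    (Z \o otimes \1%VF (F i i))%VF - (otimes \1%VF (F i i) \o Z)%VF \in h.
  move=> /(over_adr (F i i)); rewrite sbr_evenr //.
  exact: otimes_parity (parity_is1 V1) (F_even i).
move=> kl Xh; apply: (corner_mem n2) => //; rewrite ?eM ?eqxx ?scale1r //.
- by rewrite (negPf kl) scale0r.
- by rewrite eq_sym (negPf kl) scale0r.
- exact: ad.
- exact: ad.
Qed.

(** If every [P_kl] with [k != l] and every [P_kk - P_ll] were a scalar, then [X]
    would differ from [P_(p0 p0) (x) 1] by an element of [1 (x) gl(V2)]. The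
    corners of [X] give the [P_kl], those of its bracket with [1 (x) F_kl] give
    [P_kk - P_ll]. *)
Lemma over_nonscalar : h <> g ->
  exists P k l, [/\ P \in qalg J1, P \notin <[\1%VF]>%VS, k != l
                   & otimes P (F k l) \in h].
Proof.
move=> neq; have /subvPn[X Xh Xg] : ~~ (h <= g)%VS.
  by apply/negP => hg; apply: neq; apply/eqP; rewrite eqEsubv hg gh.
have [P [PQ XE]] := otimes_decomp_qalg bw hw oJ (subvP hq _ Xh).
pose sc Q := Q \in <[\1%VF : 'End(V1)]>%VS.
have off k l : k != l -> otimes (P k l) (F k l) \in h.
  by move=> kl; have := over_corner kl Xh; rewrite XE (corner_sum bw hw).
have diag k l : k != l -> otimes (P k k - P l l) (F k l) \in h.
  move=> kl; have := over_corner kl (over_adr (F k l) Xh).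
  rewrite otimesBl -(sum_delta2 (fun i j => otimes (P i j) (F k l)) k k).
  rewrite -(sum_delta2 (fun i j => otimes (P i j) (F k l)) l l) -sumrB.
  congr (_ \in h); rewrite XE sbr_suml comp_lfun_sumr comp_lfun_suml.
  apply: eq_bigr => i _.
  rewrite sbr_suml comp_lfun_sumr comp_lfun_suml -sumrB; apply: eq_bigr => j _.
  rewrite sbr_otimesr (corner_otimes bw hw) -scalerBl; congr (_ *: _).
  rewrite (sbr_munit bw hw) add_lfunE opp_lfunE !scale_lfunE !munitE.
  rewrite linearB !linearZ /= !coord_free ?(basis_free bw) // eqxx mul1r.
  rewrite (eq_sym l i) (eq_sym l j).
  have [->|] := eqVneq i l; rewrite ?mul0r ?mulr0 ?subr0.
    rewrite !eqxx (eq_sym l k) (negPf kl) mulr0 !sub0r !mul1r mulr1; congr (- _).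
    by have [->|_] := eqVneq j l; rewrite ?addbb ?mulr1 ?mulr0.
  by move=> _; rewrite -natrM mulnb andbC.
have [/existsP[k /existsP[l /andP[kl nP]]] | h1] :=
  boolP [exists k, exists l, (k != l) && ~~ sc (P k l)].
  by exists (P k l), k, l; split; rewrite ?off.
have [/existsP[k /existsP[l /andP[kl nP]]] | h2] :=
  boolP [exists k, exists l, (k != l) && ~~ sc (P k k - P l l)].
  by exists (P k k - P l l), k, l; split; rewrite ?diag //; rewrite memvB ?PQ.
case/negP: Xg.
have sc1 k l : k != l -> sc (P k l).
  move=> kl; apply: contraR h1 => nP; apply/existsP; exists k; apply/existsP.
  by exists l; rewrite kl.
have sc2 k l : sc (P k k - P l l).
  have [-> | kl] := eqVneq k l; first by rewrite /sc subrr mem0v.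
  apply: contraR h2 => nP; apply/existsP; exists k; apply/existsP.
  by exists l; rewrite kl.
have scg Q Y : sc Q -> otimes Q Y \in g.
  by case/vlineP => c ->; rewrite otimesZl memvZ ?odot_r.
have P0g : otimes (P p0 p0) \1%VF \in g by apply: odot_l.
rewrite -[X](subrK (otimes (P p0 p0) \1%VF)) memvD //.
rewrite XE -(munit_sum1 bw) otimes_sumr -sumrB.
apply: memv_suml => k _; rewrite (bigD1 k) //= addrAC memvD //.
  by rewrite -otimesBl scg.
by apply: memv_suml => l lk; rewrite scg // sc1 // eq_sym.
Qed.

Section StrictlyLarger.
Hypothesis neq : h <> g.

(** The space [S] of the [P] with [P (x) F_(p0 q0)] in [h] is a Lie ideal of
    [qalg J1]. Bracketing with [P' (x) (F_(p0 p0) - F_(q0 q0))] puts the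
    super-anticommutators of its elements in it too, hence their products. It
    contains a non-scalar, so [qalg_gen] applies. *)
Lemma over_offdiag_all P i j : P \in qalg J1 -> i != j -> otimes P (F i j) \in h.
Proof.
have [P0 [k [l [P0Q P0n kl P0h]]]] := over_nonscalar neq.
move=> PQ ij; apply: (over_offdiag pq) => //.
pose G := F p0 q0; have eG : parity_is false G.
  by have := munit_parity bw hw p0 q0; rewrite ppq addbb.
pose S : {vspace 'End(V1)} := (qalg J1 :&: (linfun (otimesl G) @^-1: h))%VS.
have memS Q : (Q \in S) = (Q \in qalg J1) && (otimes Q G \in h).
  by rewrite memv_cap -memv_preim lfunE.
suff /subvP/(_ P PQ) : (qalg J1 <= S)%VS by rewrite memS => /andP[].
have Sad Q Q' : Q \in qalg J1 -> Q' \in S -> sbr Q Q' \in S.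
  rewrite !memS => QQ /andP[Q'Q Q'h].
  by rewrite (qalg_sbr oJ) //= over_ad_left.
have Sh a Q : Q \in S -> hcomp a Q \in S.
  rewrite !memS => /andP[QQ Qh]; rewrite (qalg_hcomp oJ) //=.
  by have := hlie.1 a _ Qh; rewrite (hcomp_otimes _ _ eG) addbF.
have half Q : Q + Q \in S -> Q \in S.
  move=> /(memvZ 2%:R^-1); rewrite -mulr2n -scaler_nat scalerA mulVf //.
  by rewrite scale1r.
have Smul a b Q Q' : parity_is a Q -> parity_is b Q' -> Q \in S -> Q' \in S ->
    (Q \o Q')%VF \in S.
  move=> pQ pQ' QS Q'S; apply: half.
  have := QS; have := Q'S; rewrite !memS => /andP[Q'Q Q'h] /andP[QQ Qh].
  have QQ'h : otimes Q' (F p0 p0 - F q0 q0) \in h.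
    by have := over_ad_right (F q0 p0) Q'h; rewrite sbr_munitC ppq addbb scale1r.
  have := hlie.2 _ _ Qh QQ'h.
  rewrite (sbr_otimes_even pQ pQ' eG (parity_isB (F_even p0) (F_even q0))).
  (* Bracketing with F_(p0 p0) - F_(q0 q0) gives the super-anticommutator of Q and
     Q'; adding their supercommutator leaves twice the product. *)
  have GF : (G \o (F p0 p0 - F q0 q0))%VF = - G.
    rewrite comp_lfunDr comp_lfunNr !munit_mul ?(basis_free bw) // eqxx.
    by rewrite eq_sym (negPf pq) scale0r sub0r scale1r.
  have FG : ((F p0 p0 - F q0 q0) \o G)%VF = G.
    rewrite comp_lfunDl comp_lfunNl !munit_mul ?(basis_free bw) // eqxx.
    by rewrite eq_sym (negPf pq) scale0r subr0 scale1r.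
  rewrite GF FG -[- G]scaleN1r otimesZr scaleN1r -opprD memvN -otimesZl -otimesDl => acomm.
  have := over_ad_left QQ Q'h; rewrite (sbrE pQ pQ') => /(memvD acomm).
  rewrite -otimesDl addrACA subrr addr0 => ->.
  by rewrite memvD ?(qalgM oJ).
apply: (qalg_gen oJ JJ n2 (X := P0)) => // [Q Q' QS Q'S|]; last first.
  by rewrite memS P0Q (over_offdiag kl).
rewrite -[Q]hcomp_sum -[Q']hcomp_sum !(comp_lfunDl, comp_lfunDr).
by rewrite !memvD // (Smul _ _ _ _ (hcomp_parity _ _) (hcomp_parity _ _)) ?Sh.
Qed.

Lemma over_diag_all P i j : P \in qalg J1 ->
  otimes P (F i i) - (-1) ^+ (p i (+) p j) *: otimes P (F j j) \in h.
Proof.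
move=> PQ; rewrite -otimesZr -otimesBr -sbr_munitC.
have [-> | ij] := eqVneq i j; last by rewrite over_ad_right // over_offdiag_all.
by rewrite sbr_munitC addbb scale1r subrr otimes0r mem0v.
Qed.

(** The bracket of [P (x) F_(p0 q0)] with [Q (x) F_(q0 p0)] is
    [PQ (x) F_(p0 p0) - QP (x) F_(q0 q0)] up to the sign of the second term, and
    [QP (x) (F_(p0 p0) - F_(q0 q0))] is in [h]. *)
Lemma over_comm P Q : P \in qalg J1 -> Q \in qalg J1 ->
  otimes (sbr P Q) (F p0 p0) \in h.
Proof.
move=> PQ QQ.
have hom a b : otimes (sbr (hcomp a P) (hcomp b Q)) (F p0 p0) \in h.
  have := qalg_hcomp oJ a PQ; have := qalg_hcomp oJ b QQ.
  move: (hcomp a P) (hcomp b Q) (hcomp_parity a P) (hcomp_parity b Q).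
  move=> {PQ QQ} {}P {}Q pP pQ QQ PQ.
  have eF k l : p k = p l -> parity_is false (F k l).
    by move=> kl; have := munit_parity bw hw k l; rewrite kl addbb.
  have := hlie.2 _ _ (over_offdiag_all PQ pq) (over_offdiag_all QQ (i := q0) (j := p0) _).
  rewrite eq_sym pq => /(_ isT).
  rewrite (sbr_otimes_even pP pQ) ?eF // !munit_mul ?(basis_free bw) // !eqxx !scale1r.
  have := over_diag_all p0 q0 (qalgM oJ QQ PQ); rewrite ppq addbb scale1r.
  move=> /(memvZ ((-1) ^+ (a && b))) d1 /memvB/(_ d1).
  rewrite (sbrE pP pQ) otimesBl otimesZl scalerBr opprB addrA.
  by rewrite subrK.
have homP a : otimes (sbr (hcomp a P) Q) (F p0 p0) \in h.
  by rewrite -[Q]hcomp_sum sbrDr otimesDl memvD ?hom.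
by rewrite -[P]hcomp_sum sbrDl otimesDl memvD ?homP.
Qed.

Lemma over_reduce X : X \in qalg J ->
  exists2 P, P \in qalg J1 & X - otimes P (F p0 p0) \in h.
Proof.
move=> XQ; have [P [PQ ->]] := otimes_decomp_qalg bw hw oJ XQ.
exists (\sum_k (-1) ^+ (p k (+) p p0) *: P k k).
  by apply: memv_suml => k _; rewrite memvZ.
rewrite [otimes _ (F p0 p0)](linear_sum (otimesl (F p0 p0))) -sumrB.
apply: memv_suml => k _; rewrite (bigD1 k) //= addrAC memvD //.
  by rewrite /otimesl otimesZl over_diag_all.
by apply: memv_suml => l lk; rewrite over_offdiag_all // eq_sym.
Qed.

(** Modulo [h], [P (x) 1] is [P (x) F_(p0 p0)] times, up to sign, the supertrace
    of the identity of [V2]. *)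
Lemma over_eq_qalg : \sum_k (-1) ^+ p k != 0 :> K -> h = qalg J.
Proof.
move=> str0; apply/eqP; rewrite eqEsubv hq /=; apply/subvP => X XQ.
have [P PQ] := over_reduce XQ; suff Ph : otimes P (F p0 p0) \in h.
  by move=> /memvD/(_ Ph); rewrite subrK.
have P1h : otimes P \1%VF \in h by apply: (subvP gh); apply: odot_l.
have : \sum_k (otimes P (F k k) - (-1) ^+ (p k (+) p p0) *: otimes P (F p0 p0)) \in h.
  by apply: memv_suml => k _; apply: over_diag_all.
rewrite sumrB -otimes_sumr (munit_sum1 bw) -scaler_suml => /(memvB P1h).
rewrite opprB addrC subrK => /(memvZ (\sum_k (-1) ^+ (p k (+) p p0))^-1).
rewrite scalerA mulVf ?scale1r //.
rewrite (eq_bigr (fun k => (-1) ^+ p k * (-1) ^+ p p0)) => [|k _]; last by rewrite signr_addb.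
by rewrite -mulr_suml mulf_neq0 // signr_eq0.
Qed.

(** Every element of [qalg J] is congruent modulo [h] to a multiple of the single
    tensor [Z]. The queer trace vanishes on [h] and not on [qalg J], so it does
    not vanish on [Z] and detects the multiple. *)
Lemma over_eq_sqalg : (0 < \dim (spart V1 false))%N ->
  qtr J (qxi J) != 0 -> (h <= sqalg J)%VS -> h = sqalg J.
Proof.
move=> n0 xi0 hsq; apply/eqP; rewrite eqEsubv hsq /=.
pose i0 := Ordinal n0; pose Z := otimes (qxi J1 \o qunit J1 i0 i0)%VF (F p0 p0) : 'End(V).
have modZ X : X \in qalg J -> exists c, X - c *: Z \in h.
  move=> XQ; have [P PQ XP] := over_reduce XQ.
  pose U := (linfun (otimesl (F p0 p0)) @^-1: h)%VS.
  have memU Q : (Q \in U) = (otimes Q (F p0 p0) \in h) by rewrite -memv_preim lfunE.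
  have Uc Q Q' : Q \in qalg J1 -> Q' \in qalg J1 -> sbr Q Q' \in U.
    by move=> QQ Q'Q; rewrite memU over_comm.
  have := subvP (qalg_comm oJ JJ i0 n2 Uc) _ PQ.
  case/memv_addP => Q; rewrite memU => Qh [_ /vlineP[c ->] PE]; exists c.
  have := memvD XP Qh.
  by rewrite PE otimesDl otimesZl opprD addrA addrAC subrK.
have qh X : X \in h -> qtr J X = 0.
  by move=> /(subvP hsq); rewrite mem_sqalg => /andP[_ /eqP].
have qE X c : X - c *: Z \in h -> qtr J X = c * qtr J Z.
  by move=> /qh/eqP; rewrite -scaleN1r qtrD !qtrZ mulN1r subr_eq0 => /eqP.
have Z0 : qtr J Z != 0.
  have [c /qE E] := modZ _ (qalg_xi oJV).
  by apply: contraNneq xi0 => Z0; rewrite E Z0 mulr0.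
have sub X : X \in sqalg J -> X \in h.
  rewrite mem_sqalg -mem_qalg => /andP[XQ X0].
  have [c cX] := modZ X XQ; move: X0; rewrite (qE _ _ cX) mulf_eq0 (negPf Z0) orbF.
  by move=> /eqP c0; move: cX; rewrite c0 scale0r subr0.
exact/subvP.
Qed.

End StrictlyLarger.

End Overalgebra.
End Maximality.

(** * Maximality *)

Lemma id_lfun_neq0 (K : fieldType) (W : vectType K) (U : {vspace W}) :
  (0 < \dim U)%N -> \1%VF != 0 :> 'End(W).
Proof.
rewrite lt0n; apply: contraNneq => E; rewrite dimv_eq0 -subv0; apply/subvP => v _.
by rewrite memv0 -[v]id_lfunE E zero_lfunE.
Qed.

Lemma qxi_nonscalar (K : fieldType) (V : superspace K) (J : 'End(V)) :
  parity_is true J -> (J \o J)%VF = - \1%VF -> (0 < \dim (spart V false))%N ->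
  qxi J \notin <[\1%VF]>%VS.
Proof.
move=> oJ JJ /id_lfun_neq0; apply: contraNN => /vlineP[c xiE].
have := hcomp_id (qxi_odd oJ); rewrite {1}xiE linearZ /=.
rewrite (parity_is_hcomp (parity_is1 V)) // scaler0 => xi0.
by rewrite -(qxi_sq oJ JJ) -xi0 comp_lfun0l.
Qed.

(** Were the even part zero, the decomposition of the identity into the units
    [qunit] would be an empty sum. *)
Lemma stensor_even_neq0 (K : fieldType) (V1 V2 : superspace K) (J : 'End(V1)) :
  parity_is true J -> (J \o J)%VF = - \1%VF ->
  (0 < \dim (spart V1 false))%N -> (0 < \dim {:V2})%N ->
  (0 < \dim (spart (stensor V1 V2) false))%N.
Proof.
move=> oJ JJ n1 n2; rewrite lt0n; apply/negP => /eqP n0.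
have := qunit_sum1 (otimesJ_odd V2 oJ) (otimesJ_sq V2 oJ JJ).
rewrite big1 => [id0 | i _]; last by exfalso; case: i => i; rewrite n0.
have [d [w [p [bw hw _ _]]]] := homogeneous_basis V2.
have d0 : (0 < d)%N by rewrite -(size_basis bw).
pose k := Ordinal d0.
have : otimes \1%VF (munit w k k) = 0 :> 'End(stensor V1 V2).
  by rewrite -[LHS]comp_lfun1l -id0 comp_lfun0l.
by move/(otimes_munit_eq0 bw hw)/eqP; apply/negP/(id_lfun_neq0 n1).
Qed.

Lemma eqr_nat_pchar0 (K : fieldType) (m n : nat) :
  (forall n, (n%:R == 0 :> K) = (n == 0)%N) -> (m%:R == n%:R :> K) = (m == n).
Proof.
move=> char0; wlog mn : m n / (m <= n)%N => [h|].
  by case: (leqP m n) => [/h // | /ltnW/h E]; rewrite eq_sym E eq_sym.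
by rewrite eq_sym -subr_eq0 -natrB // char0 subn_eq0 eqn_leq mn.
Qed.

Theorem odot_maximal (K : fieldType) (V1 V2 : superspace K) (J1 : 'End(V1)) :
  [pchar K] =i pred0 ->
  parity_is true J1 -> (J1 \o J1)%VF = - \1%VF -> (0 < \dim (spart V1 false))%N ->
  (exists a, 1 < \dim (spart V2 a))%N ->
  let J : 'End(stensor V1 V2) := otimes J1 \1%VF in
  let g := odot (qalg J1) (fullv : {vspace 'End(V2)}) in
  (\dim (spart V2 false) != \dim (spart V2 true) -> maximal_in g (qalg J)) /\
  (\dim (spart V2 false) = \dim (spart V2 true) -> maximal_in g (sqalg J)).
Proof.
move=> /pcharf0P char0 oJ JJ n1 [a a1] J g.
have n2 : 2%:R != 0 :> K by rewrite char0.
have oJV : parity_is true J := otimesJ_odd V2 oJ.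
have JJV : (J \o J)%VF = - \1%VF := otimesJ_sq V2 oJ JJ.
have [d [w [p [bw hw str /(_ a a1) [k [l [kl pkl]]]]]]] := homogeneous_basis V2.
have xiQ : otimes (qxi J1) (munit w k l) \in qalg J.
  exact/(otimes_qalg oJ)/(qalg_xi oJ).
have xi_g : otimes (qxi J1) (munit w k l) \notin g.
  exact: (odot_offdiag J1 bw hw (qxi_nonscalar oJ JJ n1) kl).
have proper (L : {vspace 'End(stensor V1 V2)}) :
    otimes (qxi J1) (munit w k l) \in L -> g <> L.
  by move=> xiL gL; move: xi_g; rewrite gL xiL.
have lie := odot_lie V2 oJ.
split=> m2; split=> //.
- exact: odot_sub_qalg.
- exact: proper.
- move=> h hlie gh hL; have [-> | /eqP neq] := eqVneq h g; [by left | right].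
  apply: (over_eq_qalg n2 oJ JJ bw hw hlie gh hL kl pkl neq).
  by rewrite str subr_eq0 eqr_nat_pchar0.
- apply: (odot_sub_sqalg oJ JJ bw hw); by rewrite str m2 subrr.
- apply: proper; rewrite mem_sqalg -mem_qalg xiQ /=; apply/eqP.
  exact: (qtr_offdiag oJ JJ bw hw (qalg_xi oJ) kl).
- move=> h hlie gh hL; have [-> | /eqP neq] := eqVneq h g; [by left | right].
  have hq : (h <= qalg J)%VS by apply: subv_trans hL (capvSl _ _).
  apply: (over_eq_sqalg n2 oJ JJ bw hw hlie gh hq kl pkl neq n1 _ hL).
  rewrite (qtr_xi oJV JJV) oppr_eq0 char0 -lt0n (stensor_even_neq0 oJ JJ n1) //.
  by rewrite (leq_trans (ltnW a1)) // dimvS ?subvf.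
Qed.

Theorem theorem2p2 (R : realType) (V1 V2 : superspace R[i])
    (m1 n1 m2 n2 : nat) (J1 : 'End(V1)) :
  sdim V1 = (m1, n1) -> sdim V2 = (m2, n2) ->
  m1 = n1 -> (1 <= n1)%N ->
  (m2, n2) <> (0, 0)%N ->
  (m2, n2) <> (1, 0)%N -> (m2, n2) <> (0, 1)%N -> (m2, n2) <> (1, 1)%N ->
  parity_is true J1 -> (J1 \o J1)%VF = - \1%VF ->
  let J : 'End(stensor V1 V2) := otimes J1 \1%VF in
  let g := odot (qalg J1) (fullv : {vspace 'End(V2)}) in
  (m2 <> n2 -> maximal_in g (qalg J)) /\
  (m2 = n2 -> maximal_in g (sqalg J)).
Proof.
move=> [d1 _] [d2 d2'] m1n1 n1_gt0 N0 N1 N2 N3 oJ JJ J g.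
have char0 : [pchar R[i]] =i pred0 by exact: Num.Theory.pchar_num.
have d1_gt0 : (0 < \dim (spart V1 false))%N by rewrite d1 m1n1.
have big : exists a, (1 < \dim (spart V2 a))%N.
  case: (ltnP 1 m2) => m2_gt1; first by exists false; rewrite d2.
  exists true; rewrite d2'.
  by move: m2 n2 {d2 d2'} m2_gt1 N0 N1 N2 N3 => [|[|//]] [|[|//]].
have [max_q max_sq] := odot_maximal char0 oJ JJ d1_gt0 big.
rewrite d2 d2' in max_q max_sq.
by split=> [/eqP|]; [exact: max_q | exact: max_sq].
Qed.
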